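(* For every linear-time hypergraph transformation system $\mathcal{G}$ there is a hypergraph $\mathrm{MILL}1$ grammar $\mathcal{G}'$ with $L(\mathcal{G}')=L(\mathcal{G})$.
   Context: $\mathrm{MILL}1$ is first-order multiplicative intuitionistic linear logic (formulas from atoms $p(x_1,\dots,x_n)$ — no function symbols or constants — with $\otimes,\multimap,\exists,\forall$; standard sequent calculus with multiset antecedent and single succedent). $\mathrm{FVar}(A)$: free variables; $A[h]$: substitution. Fix a countable set $\Sigma$ of selectors, identified with variables. A $\Sigma$-typed alphabet is a set $C$ with $\mathrm{type}(c)$ a finite subset of $\Sigma$ for each $c$; each $c$ is a predicate symbol of arity $|\mathrm{type}(c)|$ with a fixed enumeration of $\mathrm{type}(c)$, and a formula $A$ with $\mathrm{FVar}(A)\subseteq\mathrm{type}(c)$ can be instantiated as $A[h]$ for $h:\mathrm{type}(c)\to\mathrm{Var}$. A hypergraph over $C$ is $H=\langle V_H,E_H,\mathit{lab}_H,\mathit{att}_H,\mathit{ext}_H\rangle$: finite nodes $V_H$ (also regarded as variables), finite hyperedges $E_H$, $\mathit{lab}_H:E_H\to C$, $\mathit{att}_H(e):\mathrm{type}(\mathit{lab}_H(e))\to V_H$, $\mathit{ext}_H:\mathrm{type}(H)\to V_H$ with $\mathrm{type}(H)\subseteq\Sigma$. Hypergraphs are considered up to isomorphism. $|H|:=|V_H|+|E_H|$. Hyperedge replacement: for $e\in E_H$ with $\mathrm{dom}(\mathit{att}_H(e))=\mathrm{type}(K)$, $H[e/K]$ is obtained by removing $e$, adding a disjoint copy of $K$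 (keeping $\mathit{ext}_H$ as the external map), and identifying $\mathit{att}_H(e)(s)$ with $\mathit{ext}_K(s)$ for each $s\in\mathrm{type}(K)$ (taking the generated equivalence on nodes). An ht-rule is $r=(H\to H')$ with $\mathrm{type}(H)=\mathrm{type}(H')$ and $\mathit{ext}_H,\mathit{ext}_{H'}$ injective; $G\Rightarrow G'$ iff $G=K[e/H]$, $G'=K[e/H']$ for some rule $H\to H'$ and some $K$, $e\in E_K$ with $\mathit{att}_K(e)$ injective. An ht-system is $\langle N,T,P,S\rangle$ with $N,T$ finite $\Sigma$-typed alphabets, $P$ a finite set of ht-rules, $S$ a hypergraph over $N\cup T$ with injective $\mathit{ext}_S$; $L(\mathcal{G})=\{H\text{ over }T\mid S\Rightarrow^* H\}$. It is linear-time if there is $c\in\mathbb{N}$ such that every $H\in L(\mathcal{G})$ has a derivation $S\Rightarrow^*H$ with at most $c\cdot|H|$ steps. Fix a variable $x_\bullet$ and a symbol $\bullet$. A hypergraph $\mathrm{MILL}1$ grammar is $\langle T,S,X,\triangleright\rangle$ with $T$ a finite $\Sigma$-typed alphabet, $\triangleright\subseteq(T\cup\{\bullet\})\times\mathrm{Fm}(\mathrm{MILL}1)$ finite with $a\triangleright A\Rightarrow\mathrm{FVar}(A)\subseteq\mathrm{type}(a)$ and $\bullet\triangleright A\Rightarrow\mathrm{FVar}(A)\subseteq\{x_\bullet\}$, and $S$ a formula with $\mathrm{FVar}(S)\subseteq X\subseteq\Sigma$. $H\in L$ iff $\mathrm{type}(H)=X$ and there are $h_V:V_H\to\mathrm{Fm}$,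 $h_E:E_H\to\mathrm{Fm}$ with $\bullet\triangleright h_V(v)$, $\mathit{lab}_H(e)\triangleright h_E(e)$, such that $\{h_E(e)[\mathit{att}_H(e)]\mid e\in E_H\},\{h_V(v)[v/x_\bullet]\mid v\in V_H\}\vdash S[\mathit{ext}_H]$ is derivable in $\mathrm{MILL}1$. *)

(* Defs.v *)
From Stdlib Require List.
From HB Require Import structures.
From mathcomp Require Import all_boot finmap.

Set Implicit Arguments.
Unset Strict Implicit.
Unset Printing Implicit Defensive.

Local Open Scope fset_scope.
Local Open Scope fmap_scope.

(* Selectors are identified with variables, so Sigma is [var] too. *)
Definition var := nat.

Section FiniteMaps.
Variable K : choiceType.

Definition fcomp (V W : Type) (g : V -> W) (f : {fmap K -> V}) : {fmap K -> W} :=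
  [fmap s : domf f => g (f s)].

Definition finj (V : Type) (f : {fmap K -> V}) : Prop :=
  injective (fun s : domf f => f s).

End FiniteMaps.

(** * First-order multiplicative intuitionistic linear logic *)

(* Formulas up to renaming of bound variables, as a nested datatype: [fm V] has
   its free variables in [V], and a quantifier binds the variable [None] of its
   body.  Mapping over variables is therefore capture-avoiding.  The predicate
   symbol of [Atom p xs] is the pair [(p, size xs)], so there are countably many
   symbols of every arity. *)
Inductive fm (V : Type) : Type :=
| Atom of nat & seq V
| Tensor of fm V & fm V
| Lolli of fm V & fm V
| Exists of fm (option V)
| Forall of fm (option V).

Arguments Atom {V}.

Fixpoint map_fm (V W : Type) (f : V -> W) (A : fm V) : fm W :=
  match A with
  | Atom p xs => Atom p (map f xs)
  | Tensor A B => Tensor (map_fm f A) (map_fm f B)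
  | Lolli A B => Lolli (map_fm f A) (map_fm f B)
  | Exists A => Exists (map_fm (omap f) A)
  | Forall A => Forall (map_fm (omap f) A)
  end.

Fixpoint fvar (V : Type) (A : fm V) : seq V :=
  match A with
  | Atom _ xs => xs
  | Tensor A B | Lolli A B => fvar A ++ fvar B
  | Exists A | Forall A => pmap id (fvar A)
  end.

Definition opt_rel (V : Type) (e : V -> V -> bool) (x y : option V) : bool :=
  match x, y with
  | Some x, Some y => e x y
  | None, None => true
  | _, _ => false
  end.

Fixpoint eqfm (V : Type) (e : V -> V -> bool) (A B : fm V) : bool :=
  match A, B with
  | Atom p xs, Atom q ys => (p == q) && all2 e xs ys
  | Tensor A1 A2, Tensor B1 B2 => eqfm e A1 B1 && eqfm e A2 B2
  | Lolli A1 A2, Lolli B1 B2 => eqfm e A1 B1 && eqfm e A2 B2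
  | Exists A, Exists B => eqfm (opt_rel e) A B
  | Forall A, Forall B => eqfm (opt_rel e) A B
  | _, _ => false
  end.

Lemma opt_relP (V : Type) (e : V -> V -> bool) :
  Equality.axiom e -> Equality.axiom (opt_rel e).
Proof.
move=> eP [x|] [y|] /=; try by constructor.
by apply: (iffP (eP x y)) => [->|[]].
Qed.

Lemma all2_eqP (V : Type) (e : V -> V -> bool) :
  Equality.axiom e -> Equality.axiom (all2 e).
Proof.
move=> eP; elim=> [|x xs IH] [|y ys] /=; try by constructor.
by apply: (iffP andP) => [[/eP-> /IH->]|[/eP xy /IH xsys]].
Qed.

Lemma eqfmP (V : Type) (e : V -> V -> bool) :
  Equality.axiom e -> Equality.axiom (eqfm e).
Proof.
move=> eP A; elim: A e eP => {V} [V p xs|V A IA B IB|V A IA B IB|V A IA|V A IA]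
  e eP [q ys|A' B'|A' B'|A'|A'] /=; try by constructor.
- by apply: (iffP andP) => [[/eqP-> /(all2_eqP eP)->]|[-> /(all2_eqP eP)->]].
- by apply: (iffP andP) => [[/(IA e eP)-> /(IB e eP)->]|[/(IA e eP)-> /(IB e eP)->]].
- by apply: (iffP andP) => [[/(IA e eP)-> /(IB e eP)->]|[/(IA e eP)-> /(IB e eP)->]].
- by apply: (iffP (IA _ (opt_relP eP) A')) => [->|[]].
- by apply: (iffP (IA _ (opt_relP eP) A')) => [->|[->]].
Qed.

HB.instance Definition _ (V : eqType) :=
  hasDecEq.Build (fm V) (eqfmP (@eqP V)).

Definition formula := fm var.

(* [A[h]]: variables outside the domain of [h] are left unchanged. *)
Definition subst (h : {fmap var -> var}) (A : formula) : formula :=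
  map_fm (fun x => odflt x h.[? x]) A.

(* [A[y/x]] for the variable [x] bound in [Exists A] or [Forall A]. *)
Definition inst (A : fm (option var)) (y : var) : formula :=
  map_fm (odflt y) A.

(* Antecedents are sequences up to permutation, that is, finite multisets. *)
Inductive derivable : seq formula -> formula -> Prop :=
| d_perm G D A : perm_eq G D -> derivable G A -> derivable D A
| d_ax A : derivable [:: A] A
| d_cut G D A B :
    derivable G A -> derivable (A :: D) B -> derivable (G ++ D) B
| d_tensorL G A B C :
    derivable [:: A, B & G] C -> derivable (Tensor A B :: G) C
| d_tensorR G D A B :
    derivable G A -> derivable D B -> derivable (G ++ D) (Tensor A B)
| d_lolliL G D A B C :
    derivable G A -> derivable (B :: D) C ->
    derivable (Lolli A B :: G ++ D) C
| d_lolliR G A B :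
    derivable (A :: G) B -> derivable G (Lolli A B)
| d_existsL G A C y :
    y \notin fvar (Exists A) -> y \notin flatten (map (@fvar var) G) ->
    y \notin fvar C ->
    derivable (inst A y :: G) C -> derivable (Exists A :: G) C
| d_existsR G A y :
    derivable G (inst A y) -> derivable G (Exists A)
| d_forallL G A C y :
    derivable (inst A y :: G) C -> derivable (Forall A :: G) C
| d_forallR G A y :
    y \notin fvar (Forall A) -> y \notin flatten (map (@fvar var) G) ->
    derivable G (inst A y) -> derivable G (Forall A).

(** * Hypergraphs and hyperedge replacement *)

Record alphabet := Alphabet {
  symbol :> choiceType;
  sel_type : symbol -> {fset var}
}.

Record hypergraph (C : alphabet) := Hypergraph {
  node : finType;
  edge : finType;
  lab : edge -> C;
  att : edge -> {fmap var -> node};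
  ext : {fmap var -> node};
  att_dom : forall e, domf (att e) = sel_type (lab e)
}.

Section Hypergraphs.
Variable C : alphabet.
Implicit Types H K : hypergraph C.

Definition htype H : {fset var} := domf (ext H).

Definition hsize H : nat := #|node H| + #|edge H|.

Definition over (D : {fset C}) H : Prop := forall e : edge H, lab e \in D.

Definition iso H K : Prop :=
  exists (f : node H -> node K) (g : edge H -> edge K),
    [/\ bijective f, bijective g,
        forall e, lab (g e) = lab e,
        forall e, att (g e) = fcomp f (att e)
      & ext K = fcomp f (ext H)].

Section Replacement.
Variables (H : hypergraph C) (e : edge H) (K : hypergraph C).

Definition glue (x y : node H + node K) : bool :=
  match x, y with
  | inl v, inr w | inr w, inl v =>
      [exists s : domf (ext K), ((att e).[? val s] == Some v) && (ext K s == w)]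
  | _, _ => false
  end.

(* [glue] is symmetric, so [connect glue] is the equivalence it generates. *)
Definition glue_class (x : node H + node K) : {set node H + node K} :=
  [set y | connect glue x y].

Definition repl_node : finType :=
  {B : {set node H + node K} | B \in [set glue_class x | x in [set: node H + node K]]}.

Lemma glue_class_in x :
  glue_class x \in [set glue_class x | x in [set: node H + node K]].
Proof. exact: imset_f. Qed.

Definition repl_proj (x : node H + node K) : repl_node :=
  exist _ (glue_class x) (glue_class_in x).

Definition repl_edge : finType := ({e' : edge H | e' != e} + edge K)%type.

Definition repl_lab (d : repl_edge) : C :=
  match d with
  | inl e' => lab (val e')
  | inr d => lab d
  end.

Definition repl_att (d : repl_edge) : {fmap var -> repl_node} :=
  match d with
  | inl e' => fcomp (repl_proj \o inl) (att (val e'))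
  | inr d => fcomp (repl_proj \o inr) (att d)
  end.

Lemma repl_att_dom d : domf (repl_att d) = sel_type (repl_lab d).
Proof. by case: d => d; exact: att_dom. Qed.

Definition replace : hypergraph C :=
  Hypergraph (fcomp (repl_proj \o inl) (ext H)) repl_att_dom.

End Replacement.
End Hypergraphs.

(** * Hypergraph transformation systems *)

(* The context in a rule application may label the replaced hyperedge by a symbol
   outside the alphabet: [C] need not have any symbol of the type of the rule.
   So [C] is extended with one symbol [None] of that type. *)
Definition with_hole (C : alphabet) (X : {fset var}) : alphabet :=
  @Alphabet (option C) (oapp (@sel_type C) X).

Definition lift_hole (C : alphabet) (X : {fset var}) (H : hypergraph C) :
    hypergraph (with_hole C X) :=
  @Hypergraph (with_hole C X) (node H) (edge H) (fun e => Some (lab e))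
    (@att C H) (ext H) (@att_dom C H).

Record ht_rule (C : alphabet) := HtRule {
  lhs : hypergraph C;
  rhs : hypergraph C;
  rule_type : htype lhs = htype rhs;
  lhs_inj : finj (ext lhs);
  rhs_inj : finj (ext rhs)
}.

Record ht_system (C : alphabet) := HtSystem {
  nonterm : {fset C};
  term : {fset C};
  rules : seq (ht_rule C);
  start : hypergraph C;
  rules_over : forall r, List.In r rules ->
    over (nonterm `|` term) (lhs r) /\ over (nonterm `|` term) (rhs r);
  start_over : over (nonterm `|` term) start;
  start_inj : finj (ext start)
}.

Section Derivations.
Variables (C : alphabet) (S : ht_system C).

Definition ht_step (G G' : hypergraph C) : Prop :=
  exists r, List.In r (rules S) /\
  exists (K : hypergraph (with_hole C (htype (lhs r)))) (e : edge K),
    [/\ domf (att e) = htype (lhs r), finj (att e),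
        iso (lift_hole _ G) (replace e (lift_hole _ (lhs r)))
      & iso (lift_hole _ G') (replace e (lift_hole _ (rhs r)))].

Inductive ht_steps : nat -> hypergraph C -> hypergraph C -> Prop :=
| ht_steps0 G G' : iso G G' -> ht_steps 0 G G'
| ht_stepsS n G1 G2 G3 :
    ht_step G1 G2 -> ht_steps n G2 G3 -> ht_steps n.+1 G1 G3.

Definition ht_language (H : hypergraph C) : Prop :=
  over (term S) H /\ exists n, ht_steps n (start S) H.

Definition linear_time : Prop :=
  exists c : nat, forall H, ht_language H ->
    exists n, n <= c * hsize H /\ ht_steps n (start S) H.

End Derivations.

(** * Hypergraph MILL1 grammars *)

Definition x_bullet : var := 0.

(* [None] is the symbol bullet, and [lexicon] is the relation written as a
   triangle. *)
Record mill1_grammar (C : alphabet) := Mill1Grammar {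
  gterm : {fset C};
  gstart : formula;
  gtype : {fset var};
  lexicon : seq (option C * formula);
  lexicon_edge : forall a A, (Some a, A) \in lexicon ->
    a \in gterm /\ {subset fvar A <= sel_type a};
  lexicon_node : forall A, (None, A) \in lexicon ->
    {subset fvar A <= [:: x_bullet]};
  gstart_fvar : {subset fvar gstart <= gtype}
}.

(* Nodes are variables: as hypergraphs are considered up to isomorphism and the
   nodes of [H] form an arbitrary finite type, [nu] is a choice of distinct
   variables for them. *)
Definition mill1_language (C : alphabet) (G : mill1_grammar C)
    (H : hypergraph C) : Prop :=
  htype H = gtype G /\
  exists (nu : node H -> var) (hV : node H -> formula) (hE : edge H -> formula),
    [/\ injective nu,
        forall v, (None, hV v) \in lexicon G,
        forall e, (Some (lab e), hE e) \in lexicon G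
      & derivable
          ([seq subst (fcomp nu (att e)) (hE e) | e <- enum (edge H)] ++
           [seq subst [fmap].[x_bullet <- nu v] (hV v) | v <- enum (node H)])
          (subst (fcomp nu (ext H)) (gstart G))].

(* Main.v *)
(* A hypergraph with distinct variables for its nodes is the multiset of its
   edges, as atoms, and of its nodes, as unary tokens.  A rule is the closed
   formula that turns the items of its right-hand side into those of its
   left-hand side under fresh names for the inner nodes; it consumes and
   restores the tokens of the external nodes as well, so tokens stay distinct and
   an edge whose node was deleted can never be used again.  A derivation with at
   most c * |H| steps needs at most c copies of rule formulas per item of H, and
   the lexicon hands them out together with the items.

   Conversely, derivable sequents are interpreted in a phase space on multisets
   of items whose pole is "if the tokens are distinct, then this is a hypergraph
   derivable from the start".  Every rule formula holds there for the empty
   multiset, so no cut elimination is needed. *)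
Require Import Defs.
From Stdlib Require Import FunctionalExtensionality.
From mathcomp Require Import all_boot finmap.
From mathcomp Require Import perm.
From mathcomp Require Import zify.

Set Implicit Arguments.
Unset Strict Implicit.
Unset Printing Implicit Defensive.

(** The universal quantifiers of a rule formula can be instantiated by any variables, so a
    derivation may merge nodes that a hypergraph step keeps apart. Such instances produce two equal
    tokens, and a pole that asks nothing of multisets with equal tokens makes them harmless. At the
    end the proviso costs nothing, because the nodes of the given hypergraph have distinct
    variables.

    The sequent starts from the items of the generated hypergraph and undoes steps until the items
    of the start hypergraph remain, which the start formula recognises. Linear time only serves to
    bound the number of rule formulas per item; the soundness argument works for every bound.

    Hyperedge replacement has the classes of a quotient as nodes. The quotient is opened once, to
    show that replacement is a union of item multisets. Items together with the external map
    determine a hypergraph up to isomorphism, so contexts can be rebuilt from items alone. *)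

Ltac permut :=
  let p := fresh "p" in
  apply/seq.permP => p;
  repeat match goal with
    H : is_true (perm_eq _ _) |- _ => move: (elimT seq.permP H p); clear H end;
  rewrite ?(count_cat, count_map) /= ?(count_cat, count_map) /=;
  rewrite /formula /var; lia.

(** * Variables of formulas *)

Lemma In_cat T (x : T) s t : List.In x (s ++ t) <-> List.In x s \/ List.In x t.
Proof. exact: List.in_app_iff. Qed.

Lemma In_mem (T : eqType) (x : T) s : reflect (List.In x s) (x \in s).
Proof.
elim: s => [|y s IH] /=; first by constructor.
rewrite inE eq_sym; apply: (iffP orP) => [[/eqP|/IH]|[->|/IH]];
  by [left|right|left; rewrite eqxx|right].
Qed.

Lemma In_pmap_Some T (x : T) s : List.In (Some x) s -> List.In x (pmap id s).
Proof.
elim: s => //= -[y|] s IH /=; first by case=> [[->]|/IH]; [left|right].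
by case=> // /IH.
Qed.

(** Stated with [List.In] because the induction passes through [fm (option V)] for arbitrary types
    [V], without decidable equality. *)
Lemma map_fm_eq_in V W (A : fm V) (f g : V -> W) :
  (forall x, List.In x (fvar A) -> f x = g x) -> map_fm f A = map_fm g A.
Proof.
elim: A W f g => {V} [V p xs|V A IA B IB|V A IA B IB|V A IA|V A IA] W f g E /=.
- by congr Atom; elim: xs E => //= x xs IH E; rewrite E ?IH; auto.
- by congr Tensor; [apply: IA|apply: IB] => x xA; apply: E; apply/In_cat; auto.
- by congr Lolli; [apply: IA|apply: IB] => x xA; apply: E; apply/In_cat; auto.
- by congr Exists; apply: IA => -[x|//] xA /=; rewrite E //; apply: In_pmap_Some.
- by congr Forall; apply: IA => -[x|//] xA /=; rewrite E //; apply: In_pmap_Some.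
Qed.

Lemma map_fm_comp V W U (A : fm V) (f : V -> W) (g : W -> U) :
  map_fm g (map_fm f A) = map_fm (g \o f) A.
Proof.
elim: A W U f g => {V} [V p xs|V A IA B IB|V A IA B IB|V A IA|V A IA] W U f g /=.
- by rewrite -map_comp.
- by rewrite IA IB.
- by rewrite IA IB.
- by rewrite IA; congr Exists; apply: map_fm_eq_in => -[].
- by rewrite IA; congr Forall; apply: map_fm_eq_in => -[].
Qed.

Lemma map_fm_id V (A : fm V) (f : V -> V) : f =1 id -> map_fm f A = A.
Proof.
elim: A f => {V} [V p xs|V A IA B IB|V A IA B IB|V A IA|V A IA] f E /=.
- by congr Atom; elim: xs => //= x xs ->; rewrite E.
- by rewrite IA ?IB.
- by rewrite IA ?IB.
- by rewrite IA // => -[x|//] /=; rewrite E.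
- by rewrite IA // => -[x|//] /=; rewrite E.
Qed.

Lemma fvar_map V W (A : fm V) (f : V -> W) : fvar (map_fm f A) = map f (fvar A).
Proof.
have pmapE U (s : seq (option U)) W' (g : U -> W') :
  pmap id (map (omap g) s) = map g (pmap id s).
  by elim: s => //= -[x|] s /= ->.
elim: A W f => {V} [V p xs|V A IA B IB|V A IA B IB|V A IA|V A IA] W f //=.
- by rewrite map_cat IA IB.
- by rewrite map_cat IA IB.
- by rewrite IA pmapE.
- by rewrite IA pmapE.
Qed.

Definition bindv (x : var) (A : formula) : fm (option var) :=
  map_fm (fun z => if z == x then None else Some z) A.

Definition foralls (xs : seq var) (A : formula) : formula :=
  foldr (fun x B => Forall (bindv x B)) A xs.

Definition lollis (As : seq formula) (B : formula) : formula := foldr (@Lolli var) B As.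

Definition upd (f : var -> var) x y z : var := if z == x then y else f z.

(** Going under a quantifier becomes an update of the renaming, so a whole prefix [foralls xs] can
    be treated by one renaming that is free on [xs]. *)
Lemma inst_bindv f x A y :
  inst (map_fm (omap f) (bindv x A)) y = map_fm (upd f x y) A.
Proof.
rewrite /inst /bindv !map_fm_comp; apply: map_fm_eq_in => z _ /=.
by rewrite /upd; case: (z == x).
Qed.

Lemma fvar_foralls xs A z :
  z \in fvar (foralls xs A) = (z \notin xs) && (z \in fvar A).
Proof.
elim: xs => //= x xs IH; rewrite inE negb_or -andbA -IH {IH} /bindv fvar_map.
move: (fvar _) => s; elim: s => //= [|y s IH]; first by rewrite andbF.
case: (eqVneq y x) => [->|ne] /=; rewrite ?inE IH.
  by case: (eqVneq z x).
by case: (eqVneq z y) => //= ->; rewrite ne.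
Qed.

Definition fresh_var (s : seq var) : var := (sumn s).+1.

Lemma leq_sumn (s : seq nat) x : x \in s -> x <= sumn s.
Proof.
elim: s => //= y s IH; rewrite inE => /orP[/eqP->|/IH]; first exact: leq_addr.
by move=> le_x; apply: leq_trans le_x _; exact: leq_addl.
Qed.

Lemma fresh_varP s : fresh_var s \notin s.
Proof. by apply/negP => /leq_sumn; rewrite ltnn. Qed.

(** * Derivations *)

Lemma derivable_forallsL xs A B G (f g : var -> var) :
  {in predC (mem xs), g =1 f} ->
  derivable (map_fm g A :: G) B -> derivable (map_fm f (foralls xs A) :: G) B.
Proof.
elim: xs f => [|x xs IH] f E dA /=.
  by rewrite (@map_fm_eq_in _ _ _ _ g) // => z _; rewrite E.
apply: (@d_forallL _ _ _ (g x)); rewrite inst_bindv; apply: IH => // z.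
rewrite !inE => zxs; rewrite /upd; case: (eqVneq z x) => [->//|ne].
by apply: E; rewrite !inE negb_or ne.
Qed.

(** [F] collects variables to avoid beyond the eigenvariable conditions. Each eigenvariable joins
    [F] for the remaining prefix, which makes the final renaming injective on [xs]. *)
Lemma derivable_forallsR xs A G (f : var -> var) (F : seq var) : uniq xs ->
  (forall g, {in predC (mem xs), g =1 f} -> {in xs &, injective g} ->
     {in xs, forall x, g x \notin F} -> derivable G (map_fm g A)) ->
  derivable G (map_fm f (foralls xs A)).
Proof.
elim: xs f F => [|x xs IH] f F /=; first by move=> _; apply.
case/andP=> xxs uxs dA.
pose y := fresh_var (F ++ fvar (Forall (map_fm (omap f) (bindv x (foralls xs A))))
                       ++ flatten (map (@fvar var) G)).
have := fresh_varP _ : y \notin _; rewrite !mem_cat !negb_or => /and3P[yF yA yG].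
apply: (@d_forallR _ _ y) => //; rewrite inst_bindv; apply: (IH _ (y :: F)) => //.
move=> g E gI gF; have gx : g x = y by rewrite E // /upd eqxx.
apply: dA.
- move=> z; rewrite !inE negb_or => /andP[ne zxs].
  by rewrite E // /upd (negPf ne).
- move=> u v; rewrite !inE => /orP[/eqP->|u_xs] /orP[/eqP->|vxs] //.
  + by move=> e; have := gF _ vxs; rewrite -e gx inE eqxx.
  + by move=> e; have := gF _ u_xs; rewrite e gx inE eqxx.
  + exact: gI.
- move=> z; rewrite inE => /orP[/eqP->|/gF]; first by rewrite gx.
  by rewrite inE negb_or => /andP[].
Qed.

Lemma derivable_lollisL As B : derivable (lollis As B :: As) B.
Proof.
elim: As => [|A As IH] /=; first exact: d_ax.
exact: (@d_lolliL [:: A] As A (lollis As B) B (d_ax A) IH).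
Qed.

Lemma derivable_lollisR As B G : derivable (G ++ As) B -> derivable G (lollis As B).
Proof.
elim: As G => [|A As IH] G /=; first by rewrite cats0.
move=> dB; apply: d_lolliR; apply: IH; apply: d_perm dB; permut.
Qed.

(** * Phase semantics *)

Section PhaseSemantics.
Variable I : eqType.
Notation M := (seq I).
Variable pole : M -> Prop.
Hypothesis pole_perm : forall m m', perm_eq m m' -> pole m -> pole m'.
Variable atm : nat -> seq var -> M -> Prop.

(** The biorthogonal closure of [X] with respect to [pole], with multisets as tests. *)
Definition fact (X : M -> Prop) (m : M) : Prop :=
  forall k, (forall x, X x -> pole (k ++ x)) -> pole (k ++ m).

Hypothesis atm_closed : forall p xs m, fact (atm p xs) m -> atm p xs m.

(** Only [Tensor] and [Exists] need an explicit closure; [Lolli] and [Forall] inherit it from their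
    components. *)
Fixpoint sem (V : Type) (A : fm V) : (V -> var) -> M -> Prop :=
  match A with
  | Atom p xs => fun rho => atm p (map rho xs)
  | Tensor A B => fun rho =>
      fact (fun m => exists a b, [/\ m = a ++ b, sem A rho a & sem B rho b])
  | Lolli A B => fun rho m => forall a, sem A rho a -> sem B rho (m ++ a)
  | Exists A => fun rho => fact (fun m => exists d, sem A (oapp rho d) m)
  | Forall A => fun rho m => forall d, sem A (oapp rho d) m
  end.

Lemma fact_unit (X : M -> Prop) m : X m -> fact X m.
Proof. by move=> Xm k; apply. Qed.

Lemma fact_mono (X Y : M -> Prop) m : (forall x, X x -> Y x) -> fact X m -> fact Y m.
Proof. by move=> XY Xm k kY; apply: Xm => x /XY/kY. Qed.

Lemma fact_idem X m : fact (fact X) m -> fact X m.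
Proof. by move=> Xm k kX; apply: Xm => x; apply. Qed.

Lemma sem_closed V (A : fm V) rho m : fact (sem A rho) m -> sem A rho m.
Proof.
elim: A rho m => {V} [V p xs|V A _ B _|V A IA B IB|V A IA|V A IA] rho m /=.
- exact: atm_closed.
- exact: fact_idem.
- move=> Fm a Aa; apply: IB => k kB.
  apply: (@pole_perm ((k ++ a) ++ m)); first by permut.
  apply: Fm => x /(_ _ Aa)/kB; apply: pole_perm; permut.
- exact: fact_idem.
- by move=> Fm d; apply: IA; apply: fact_mono Fm => x; apply.
Qed.

Lemma sem_perm V (A : fm V) rho m m' : perm_eq m m' -> sem A rho m -> sem A rho m'.
Proof.
move=> mm' Am; apply: sem_closed => k /(_ _ Am).
by apply: pole_perm; rewrite perm_cat2l.
Qed.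

Lemma sem_eq_in V (A : fm V) (rho rho' : V -> var) :
  (forall x, List.In x (fvar A) -> rho x = rho' x) -> sem A rho = sem A rho'.
Proof.
elim: A rho rho' => {V} [V p xs|V A IA B IB|V A IA B IB|V A IA|V A IA] rho rho' E /=.
- by congr atm; elim: xs E => //= x xs IH E; rewrite E ?IH; auto.
- by rewrite (IA rho rho') ?(IB rho rho') // => x xA; apply: E; apply/In_cat; auto.
- by rewrite (IA rho rho') ?(IB rho rho') // => x xA; apply: E; apply/In_cat; auto.
- apply: (f_equal (fun S : var -> M -> Prop => fact (fun m => exists d, S d m))).
  apply: functional_extensionality => d.
  by apply: IA => -[x|//] xA /=; rewrite E //; apply: In_pmap_Some.
- apply: (f_equal (fun (S : var -> M -> Prop) m => forall d, S d m)).
  apply: functional_extensionality => d.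
  by apply: IA => -[x|//] xA /=; rewrite E //; apply: In_pmap_Some.
Qed.

Lemma sem_map V W (A : fm V) (f : V -> W) rho :
  sem (map_fm f A) rho = sem A (rho \o f).
Proof.
elim: A W f rho => {V} [V p xs|V A IA B IB|V A IA B IB|V A IA|V A IA] W f rho /=.
- by rewrite -map_comp.
- by rewrite IA IB.
- by rewrite IA IB.
- apply: (f_equal (fun S : var -> M -> Prop => fact (fun m => exists d, S d m))).
  by apply: functional_extensionality => d; rewrite IA; apply: sem_eq_in => -[].
- apply: (f_equal (fun (S : var -> M -> Prop) m => forall d, S d m)).
  by apply: functional_extensionality => d; rewrite IA; apply: sem_eq_in => -[].
Qed.

Fixpoint semctx (G : seq formula) (rho : var -> var) (m : M) : Prop :=
  if G is A :: G then
    exists a b, [/\ perm_eq m (a ++ b), sem A rho a & semctx G rho b]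
  else m = [::].

Lemma semctx_perm G rho m m' : perm_eq m m' -> semctx G rho m -> semctx G rho m'.
Proof.
case: G => [|A G] /=; first by move=> p e; move: p; rewrite e perm_sym => /perm_nilP.
move=> mm' [a [b [mab Aa Gb]]]; exists a, b; split=> //.
by apply: perm_trans mab; rewrite perm_sym.
Qed.

Lemma semctx_cat G D rho m :
  semctx (G ++ D) rho m <->
  exists a b, [/\ perm_eq m (a ++ b), semctx G rho a & semctx D rho b].
Proof.
elim: G m => [|A G IH] m /=.
  split=> [Dm|[a [b [mab a0 Db]]]]; first by exists [::], m.
  rewrite a0 in mab; by apply: semctx_perm Db; rewrite perm_sym.
split=> [[a [b [mab Aa /IH[a' [b' [bab Ga Db]]]]]]|].
  exists (a ++ a'), b'; split=> //; last by exists a, a'.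
  by permut.
case=> [a [b [mab [a1 [a2 [aa Aa Ga]]] Db]]]; exists a1, (a2 ++ b); split=> //.
  by permut.
by apply/IH; exists a2, b.
Qed.

Lemma semctx_permG G D rho m : perm_eq G D -> semctx G rho m -> semctx D rho m.
Proof.
(* Block exchanges generate all permutations. *)
move=> GD; move: GD; apply: (@catCA_perm_ind _ (fun D => semctx D rho m)).
move=> s1 s2 s3.
case/semctx_cat=> a [b [mab s1a /semctx_cat[b1 [b2 [bb s2b s3b]]]]].
apply/semctx_cat; exists b1, (a ++ b2); split=> //; first by permut.
by apply/semctx_cat; exists a, b2.
Qed.

Lemma semctx_eq_in G rho rho' m :
  {in flatten (map (@fvar var) G), rho =1 rho'} -> semctx G rho m -> semctx G rho' m.
Proof.
elim: G m => //= A G IH m E [a [b [mab Aa Gb]]]; exists a, b; split=> //.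
  rewrite -(@sem_eq_in _ _ rho) // => x /In_mem xA.
  by apply: E; rewrite mem_cat xA.
by apply: IH Gb => x xG; apply: E; rewrite mem_cat xG orbT.
Qed.

Lemma sem_inst (A : fm (option var)) y rho d : y \notin pmap id (fvar A) ->
  sem (inst A y) (upd rho y d) = sem A (oapp rho d).
Proof.
move=> yA; rewrite /inst sem_map; apply: sem_eq_in => -[x|] /= xA; last by rewrite /upd eqxx.
rewrite /upd; case: eqVneq => // e; move: yA.
by rewrite -e (introT (In_mem _ _) (In_pmap_Some xA)).
Qed.

Lemma upd_notin (s : seq var) rho y d : y \notin s -> {in s, rho =1 upd rho y d}.
Proof. by move=> ys x xs; rewrite /upd; case: eqVneq xs ys => // -> ->. Qed.

Lemma sem_sound G A rho m : derivable G A -> semctx G rho m -> sem A rho m.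
Proof.
move=> dA; elim: dA rho m => {G A}
  [G D A GD _ IH|A|G D A B _ IA _ IB|G A B C _ IH|G D A B _ IA _ IB|
   G D A B C _ IA _ IB|G A B _ IH|G A C y yA yG yC _ IH|G A y _ IH|
   G A C y _ IH|G A y yA yG _ IH] rho m.
- by move=> Dm; apply: IH; apply: semctx_permG Dm; rewrite perm_sym.
- case=> a [b [mab Aa b0]]; rewrite b0 cats0 perm_sym in mab.
  exact: sem_perm mab Aa.
- case/semctx_cat=> a [b [mab /IA Aa Db]]; apply: IB.
  by exists a, b.
(* The conclusion is closed, so checking it against a test [k] suffices; [k ++ b] is then a test
   against which the closure of the tensor can be opened. *)
- case=> t [b [mtb Tt Gb]]; apply: sem_closed => k kC.
  apply: (@pole_perm ((k ++ b) ++ t)); first by permut.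
  apply: Tt => x [a1 [a2 [-> Aa Ba]]].
  apply: (@pole_perm (k ++ (a1 ++ a2 ++ b))); first by permut.
  by apply: kC; apply: IH; exists a1, (a2 ++ b); split=> //; exists a2, b.
- case/semctx_cat=> a [b [mab /IA Aa /IB Db]].
  apply: (@sem_perm _ _ _ (a ++ b)); first by rewrite perm_sym.
  by apply: fact_unit; exists a, b.
- case=> l [b [mlb Ll /semctx_cat[g [d [bgd /IA Ag Dd]]]]].
  apply: IB; exists (l ++ g), d; split=> //; first by permut.
  exact: Ll.
- by move=> Gm a Aa; apply: IH; exists a, m; split=> //; rewrite perm_catC.
- case=> t [b [mtb Tt Gb]]; apply: sem_closed => k kC.
  apply: (@pole_perm ((k ++ b) ++ t)); first by permut.
  apply: Tt => x [d Ax].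
  apply: (@pole_perm (k ++ (x ++ b))); first by permut.
  (* The eigenvariable [y] is revalued to the witness [d], which neither [C] nor [G] can notice. *)
  apply: kC; rewrite (@sem_eq_in _ _ rho (upd rho y d)); last first.
    by move=> z /In_mem; apply: upd_notin.
  apply: IH; exists x, b; split=> //; first by rewrite sem_inst.
  by apply: semctx_eq_in Gb; apply: upd_notin.
- move=> /IH; rewrite /inst sem_map => Am; apply: fact_unit; exists (rho y).
  change (sem A (oapp rho (rho y)) m).
  by rewrite (@sem_eq_in _ A _ (rho \o odflt y)) // => -[].
- case=> t [b [mtb Tt Gb]]; apply: IH; exists t, b; split=> //.
  rewrite /inst sem_map (@sem_eq_in _ A _ (oapp rho (rho y))); last by case.
  exact: Tt.
- move=> Gm d; change (sem A (oapp rho d) m); rewrite -(sem_inst _ _ yA); apply: IH.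
  by apply: semctx_eq_in Gm; apply: upd_notin.
Qed.

Lemma sem_foralls xs A rho m :
  sem (foralls xs A) rho m <->
  forall rho', {in predC (mem xs), rho' =1 rho} -> sem A rho' m.
Proof.
elim: xs rho => [|x xs IH] rho /=.
  split=> [Am rho' E|]; last exact.
  by rewrite (@sem_eq_in _ _ _ rho) // => z _; apply: E.
have E d : sem (bindv x (foralls xs A)) (oapp rho d) =
           sem (foralls xs A) (upd rho x d).
  by rewrite sem_map; apply: sem_eq_in => z _ /=; rewrite /upd; case: (z == x).
split=> [Am rho' Er|Am d].
  have := Am (rho' x); rewrite E => /IH; apply=> z.
  rewrite !inE => zxs; rewrite /upd; case: (eqVneq z x) => [->//|ne].
  by apply: Er; rewrite !inE negb_or ne.
rewrite E; apply/IH => rho' Er; apply: Am => z.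
by rewrite !inE negb_or => /andP[ne zxs]; rewrite Er // /upd (negPf ne).
Qed.

End PhaseSemantics.

(** * Hypergraphs as multisets of items *)

Local Open Scope fset_scope.
Local Open Scope fmap_scope.

Section Vals.
Variable K : choiceType.

(** The enumeration order of the domain serves as the fixed enumeration of the type of a symbol;
    [pmap] drops nothing here. *)
Definition vals (V : Type) (a : {fmap K -> V}) : seq V :=
  pmap (fun s => a.[? s]) (domf a).

Lemma fcompE (V W : Type) (g : V -> W) (a : {fmap K -> V}) s :
  (fcomp g a).[? s] = omap g a.[? s].
Proof.
case: fndP => sa; last by rewrite not_fnd.
by rewrite ffunE in_fnd /=; congr (Some (g _)); rewrite /fnd; congr (a _); apply: val_inj.
Qed.

Lemma vals_fcomp (V W : Type) (g : V -> W) (a : {fmap K -> V}) :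
  vals (fcomp g a) = map g (vals a).
Proof.
rewrite /vals /=; elim: (enum_fset _) => //= s l IH.
by rewrite fcompE IH; case: (a.[? s]).
Qed.

Lemma fcomp_comp (V W U : Type) (f : V -> W) (g : W -> U) (a : {fmap K -> V}) :
  fcomp g (fcomp f a) = fcomp (g \o f) a.
Proof. by apply/fmapP => s; rewrite !fcompE; case: (a.[? s]). Qed.

Lemma eq_fcomp (V W : Type) (f g : V -> W) (a : {fmap K -> V}) :
  f =1 g -> fcomp f a = fcomp g a.
Proof. by move=> E; apply/fmapP => s; rewrite !fcompE; case: (a.[? s]) => //= x; rewrite E. Qed.

Lemma fcomp_id (V : Type) (a : {fmap K -> V}) : fcomp id a = a.
Proof. by apply/fmapP => s; rewrite !fcompE; case: (a.[? s]). Qed.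

Lemma size_vals (V : Type) (a : {fmap K -> V}) : size (vals a) = size (domf a).
Proof.
rewrite /vals size_pmap; apply/eqP; rewrite -all_count; apply/allP => s.
by rewrite -fndSome.
Qed.

Lemma vals_inj (V : Type) (a b : {fmap K -> V}) :
  domf a = domf b -> vals a = vals b -> a = b.
Proof.
move=> dab; have /(congr1 (@enum_fset K)) el := dab.
have Sa t : t \in domf b -> exists x, a.[? t] = Some x.
  by rewrite -dab => ta; exists a.[ta]; rewrite in_fnd.
have Sb t : t \in domf b -> exists x, b.[? t] = Some x.
  by move=> tb; exists b.[tb]; rewrite in_fnd.
rewrite /vals el => E; apply/fmapP => s.
case: (boolP (s \in domf b)) => sb; last first.
  have sa : s \notin domf a by rewrite dab.
  by rewrite (not_fnd sa) (not_fnd sb).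
suff H l : {subset l <= domf b} -> s \in l ->
    pmap (fun s => a.[? s]) l = pmap (fun s => b.[? s]) l -> a.[? s] = b.[? s].
  exact: H E.
elim: l => //= t l IH sub; rewrite inE.
have [x ax] := Sa t (sub _ (mem_head _ _)); have [y bx] := Sb t (sub _ (mem_head _ _)).
rewrite ax bx /= => st [xy Exy].
case/orP: st => [/eqP->|sl]; first by rewrite ax bx xy.
by apply: IH => // z zl; apply: sub; rewrite inE zl orbT.
Qed.

Lemma mem_vals (V : eqType) (a : {fmap K -> V}) v :
  reflect (exists s, a.[? s] = Some v) (v \in vals a).
Proof.
rewrite mem_pmap; apply: (iffP mapP) => [[s _ ->]|[s e]]; exists s => //.
by rewrite -fndSome e.
Qed.

Lemma finj_fnd (V : Type) (a : {fmap K -> V}) s t v :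
  finj a -> a.[? s] = Some v -> a.[? t] = Some v -> s = t.
Proof.
move=> ia; case: fndP => // sa [es]; case: fndP => // ta [et].
by have := ia [` sa] [` ta]; rewrite es et => /(_ erefl) /(congr1 val).
Qed.

Lemma uniq_vals (V : eqType) (a : {fmap K -> V}) : finj a -> uniq (vals a).
Proof.
move=> ia; rewrite /vals; have := fset_uniq (domf a).
elim: (enum_fset _) => //= s l IH /andP[sl /IH{}IH].
case e: (a.[? s]) => [x|//] /=; rewrite IH andbT.
rewrite mem_pmap; apply/mapP => -[t tl /esym et].
by rewrite (finj_fnd ia e et) tl in sl.
Qed.

Lemma uniq_vals_finj (V : eqType) (a : {fmap K -> V}) : uniq (vals a) -> finj a.
Proof.
move=> ua [s sa] [t ta] /= e; apply: val_inj => /=.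
have es p (pa : p \in domf a) : a.[? p] = Some a.[pa] by rewrite in_fnd.
have est : a.[? s] = a.[? t] by rewrite (es _ sa) (es _ ta) e.
suff H l : s \in l -> t \in l -> uniq (pmap (fun s => a.[? s]) l) -> s = t.
  exact: (H _ sa ta).
elim: l => //= p l IH; rewrite !inE => sl tl.
case ep: (a.[? p]) => [x|] /=; last first.
  apply: IH.
  - by case/orP: sl ep => // /eqP <-; rewrite (es _ sa).
  - by case/orP: tl ep => // /eqP <-; rewrite (es _ ta).
case/andP=> xl ul; case/orP: sl tl => [/eqP sp|sl] /orP[/eqP tp|tl].
- by rewrite sp tp.
- by case/negP: xl; rewrite mem_pmap -ep -sp est map_f.
- by case/negP: xl; rewrite mem_pmap -ep -tp -est map_f.
- exact: IH.
Qed.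

Lemma finj_fcomp (V W : Type) (g : V -> W) (a : {fmap K -> V}) :
  injective g -> finj a -> finj (fcomp g a).
Proof. by move=> ig ia s t /=; rewrite !ffunE => /ig/ia. Qed.

Lemma fcomp_inj (V W : Type) (g : V -> W) (a b : {fmap K -> V}) :
  injective g -> fcomp g a = fcomp g b -> a = b.
Proof.
move=> ig E; apply/fmapP => s; have := congr1 (fun h : {fmap K -> W} => h.[? s]) E.
by rewrite !fcompE; case: (a.[? s]) (b.[? s]) => [x|] [y|] //= [/ig->].
Qed.

End Vals.

(** Values may repeat, as for parallel hyperedges, so the bijection is read off a permutation of
    positions and not off the values. *)
Lemma perm_enum_bij (A B : finType) (T : eqType) (f : A -> T) (g : B -> T) :
  perm_eq (map f (enum A)) (map g (enum B)) ->
  exists2 h : A -> B, bijective h & forall a, g (h a) = f a.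
Proof.
move=> p; have eAB : #|A| = #|B| by rewrite !cardE -(size_map f) (perm_size p) size_map.
have /tuple_permP[s es] : perm_eq (map f (enum A)) (map_tuple g (enum_tuple B)) by [].
exists (fun a => enum_val (s (cast_ord eAB (enum_rank a)))).
  apply: inj_card_bij; last by rewrite eAB.
  by move=> x y /enum_val_inj/perm_inj/cast_ord_inj/enum_rank_inj.
move=> a; set i := cast_ord _ _; set b := enum_val _.
have := congr1 (fun l => nth (f a) l i) es.
rewrite (nth_map a) /= -?cardE ?ltn_ord // nth_enum_rank => ->.
rewrite -[nat_of_ord (enum_rank a)]/(nat_of_ord i) (nth_map i) ?size_enum_ord // nth_ord_enum.
by rewrite tnth_map (tnth_nth b) -enum_val_nth.
Qed.

Lemma fmap_of_vals (K : choiceType) (V : Type) (X : {fset K}) (xs : seq V) :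
  size xs = size X -> exists2 a : {fmap K -> V}, domf a = X & vals a = xs.
Proof.
case: xs => [|x0 xs] sz.
  have -> : X = fset0 by apply/eqP; rewrite -cardfs_eq0 -sz.
  by exists [fmap] => //; apply: size0nil; rewrite size_vals.
set l := x0 :: xs in sz *.
exists [fmap s : X => nth x0 l (index (val s) X)] => //.
rewrite /vals /=; transitivity (map (fun s => nth x0 l (index s X)) (enum_fset X)).
  suff H r : {subset r <= X} ->
      pmap (fun s => [fmap s : X => nth x0 l (index (val s) X)].[? s]) r =
      map (fun s => nth x0 l (index s X)) r by apply: H.
  elim: r => //= s r IH sub; rewrite IH; last by move=> t tr; apply: sub; rewrite inE tr orbT.
  by rewrite in_fnd ?sub ?mem_head //= => sX; rewrite ffunE.
apply: (@eq_from_nth _ x0); first by rewrite size_map sz.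
move=> i; rewrite size_map => iX.
have [s0 _] : exists s0 : K, true by case: (enum_fset X) iX => // s0; exists s0.
by rewrite (nth_map s0) // index_uniq ?fset_uniq.
Qed.

Section Items.
Variable C : alphabet.

(* A node with variable [v] is the item [(None, [:: v])]. *)
Definition items (H : hypergraph C) (nu : node H -> var) : seq (option C * seq var) :=
  [seq (Some (lab e), map nu (vals (att e))) | e <- enum (edge H)] ++
  [seq (None, [:: nu v]) | v <- enum (node H)].

Definition toks (m : seq (option C * seq var)) : seq (seq var) :=
  [seq x.2 | x <- m & ~~ isSome x.1].

Lemma toks_cat m m' : toks (m ++ m') = toks m ++ toks m'.
Proof. by rewrite /toks filter_cat map_cat. Qed.

Lemma perm_toks m m' : perm_eq m m' -> perm_eq (toks m) (toks m').
Proof. by move=> p; apply: perm_map; apply: perm_filter. Qed.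

Lemma toks_items H nu : toks (@items H nu) = [seq [:: nu v] | v <- enum (node H)].
Proof.
rewrite /toks filter_cat !filter_map.
rewrite (eq_filter (a2 := pred0)) // filter_pred0 /=.
by rewrite (eq_filter (a2 := predT)) // filter_predT -map_comp.
Qed.

Lemma uniq_toks_items m H nu : uniq (toks (m ++ @items H nu)) ->
  [/\ uniq (toks m), injective nu & forall v, [:: nu v] \notin toks m].
Proof.
rewrite toks_cat toks_items cat_uniq => /and3P[-> /hasPn h um]; split=> //.
  have /injectiveP inj : injectiveb (fun v => [:: nu v]) := um.
  by move=> v w vw; apply: inj; rewrite vw.
by move=> v; apply: h; rewrite (map_f (fun v => [:: nu v])) ?mem_enum.
Qed.

(** Tokens force the node bijection, [nu' (f v) = nu v]; edge items yield an edge bijection that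
    preserves labels and, as [nu'] is injective, attachments. *)
Lemma items_iso (H H' : hypergraph C) nu nu' : injective nu -> injective nu' ->
  perm_eq (@items H nu) (@items H' nu') -> fcomp nu (ext H) = fcomp nu' (ext H') ->
  iso H H'.
Proof.
move=> nI nI' p eX.
have /perm_enum_bij[f fB fE] : perm_eq [seq [:: nu v] | v <- enum (node H)]
    [seq [:: nu' v] | v <- enum (node H')] by rewrite -!toks_items perm_toks.
have filterE K mu : filter (fun x => isSome x.1) (@items K mu) =
    [seq (Some (lab e), map mu (vals (att e))) | e <- enum (edge K)].
  rewrite filter_cat !filter_map (eq_filter (a2 := predT)) // filter_predT.
  by rewrite (eq_filter (a2 := pred0)) // filter_pred0 cats0.
have := perm_filter (fun x => isSome x.1) p; rewrite !filterE.
case/perm_enum_bij=> g gB gE.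
have {}fE v : nu' (f v) = nu v by have [] := fE v.
exists f, g; split=> //.
- by move=> e; have [] := gE e.
- move=> e; have [el ea] := gE e.
  apply: vals_inj; first by rewrite /= !att_dom el.
  apply: (inj_map nI'); rewrite vals_fcomp ea -map_comp.
  by apply: eq_map => v /=; rewrite fE.
- apply: (fcomp_inj nI'); rewrite -eX fcomp_comp.
  by apply: eq_fcomp => v /=; rewrite fE.
Qed.

Lemma injective_ext (H : hypergraph C) (nu : node H -> var) :
  finj (fcomp nu (ext H)) -> {in predC (mem (vals (ext H))) &, injective nu} ->
  (forall v w, v \in vals (ext H) -> w \notin vals (ext H) -> nu v <> nu w) ->
  injective nu.
Proof.
move=> eI iI mix v w vw.
case: (boolP (v \in vals (ext H))) => vX; case: (boolP (w \in vals (ext H))) => wX.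
- case/mem_vals: vX => s sv; case/mem_vals: wX => t tw.
  have st : s = t by apply: (finj_fnd (v := nu v) eI); rewrite fcompE (sv, tw) //= vw.
  by move: tw; rewrite -st sv => -[].
- by case: (mix _ _ vX wX).
- by case: (mix _ _ wX vX).
- exact: iI.
Qed.

(** By [items_wf] and [wf_items_graph] these conditions characterise, up to permutation, the item
    multisets of hypergraphs with distinct node variables. *)
Definition wf_items (m : seq (option C * seq var)) : Prop :=
  uniq (toks m) /\ forall x, x \in m ->
    if x.1 is Some c then
      size x.2 = size (sel_type c) /\ (forall v, v \in x.2 -> [:: v] \in toks m)
    else exists v, x.2 = [:: v].

Lemma perm_wf_items m m' : perm_eq m m' -> wf_items m -> wf_items m'.
Proof.
move=> p [um Wm]; split; first by rewrite -(perm_uniq (perm_toks p)).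
move=> x; rewrite -(perm_mem p) => /Wm.
case: x.1 => [c|//] [sz sub]; split=> // v /sub.
by rewrite (perm_mem (perm_toks p)).
Qed.

Lemma items_wf H nu : injective nu -> wf_items (@items H nu).
Proof.
move=> nI; split.
  by rewrite toks_items map_inj_uniq ?enum_uniq // => u v [/nI].
move=> x; rewrite toks_items mem_cat => /orP[/mapP[e _ ->]|/mapP[v _ ->]] /=.
  split; first by rewrite size_map size_vals att_dom.
  by move=> v /mapP[u _ ->]; apply: map_f; rewrite mem_enum.
by exists (nu v).
Qed.

Lemma fmap_of_seq_sub (ts : seq var) (X : {fset var}) (xs : seq var) :
  {subset xs <= ts} -> size xs = size X ->
  exists2 a : {fmap var -> seq_sub ts}, domf a = X & map val (vals a) = xs.
Proof.
move=> sub sz.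
have [ys ysE] : exists ys : seq (seq_sub ts), map val ys = xs.
  elim: xs {sz} sub => [|x xs IH] sub; first by exists [::].
  have [|ys <-] := IH; first by move=> y yxs; apply: sub; rewrite inE yxs orbT.
  by exists (SeqSub (sub _ (mem_head _ _)) :: ys).
have [|a da va] := @fmap_of_vals _ _ X ys; first by rewrite -sz -ysE size_map.
by exists a; rewrite // va.
Qed.

(** Nodes are the variables that have a token; hyperedges are positions in the list of edge items,
    so that repeated items give parallel edges. *)
Lemma wf_items_graph m (d : {fmap var -> var}) : wf_items m ->
  (forall v, v \in vals d -> [:: v] \in toks m) ->
  exists (H : hypergraph C) (nu : node H -> var),
    [/\ injective nu, perm_eq (items nu) m & fcomp nu (ext H) = d].
Proof.
move=> [um Wm] Wd.
pose es := pmap (fun x => omap (fun c => (c, x.2)) x.1) m.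
pose ts := flatten (toks m).
have tsE : toks m = map (fun v => [:: v]) ts.
  have : forall xs, xs \in toks m -> exists v, xs = [:: v].
    move=> xs /mapP[x]; rewrite mem_filter => /andP[nx /Wm] Wx ->.
    by move: nx Wx; case: x.1.
  rewrite /ts; elim: (toks m) => //= xs l IH E.
  have [v ->] := E _ (mem_head _ _); rewrite /= -IH // => ys yl.
  by apply: E; rewrite inE yl orbT.
have mE : perm_eq ([seq (Some x.1, x.2) | x <- es] ++ [seq (None, [:: v]) | v <- ts]) m.
  have -> : [seq (None, [:: v]) | v <- ts] = [seq (None : option C, x) | x <- toks m].
    by rewrite tsE -map_comp.
  rewrite /es /toks; elim: (m) => //= -[[c|] xs] l IH /=; first by rewrite perm_cons.
  by rewrite -cat1s perm_catCA /= perm_cons.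
have tsu : uniq ts by move: um; rewrite tsE map_inj_uniq // => u v [].
have mem_ts v : ([:: v] \in toks m) = (v \in ts).
  by rewrite tsE mem_map // => u w [].
have esP (i : 'I_(size es)) : exists a : {fmap var -> seq_sub ts},
    domf a = sel_type (tnth (in_tuple es) i).1 /\
    map val (vals a) = (tnth (in_tuple es) i).2.
  have : (Some (tnth (in_tuple es) i).1, (tnth (in_tuple es) i).2) \in m.
    rewrite -(perm_mem mE) mem_cat; apply/orP; left.
    by apply/mapP; exists (tnth (in_tuple es) i); rewrite ?mem_tnth.
  move/Wm => /= [sz sub].
  have [|a da va] := @fmap_of_seq_sub ts _ _ _ sz; last by exists a.
  by move=> v /sub; rewrite mem_ts.
have [a aP] := fin_all_exists esP.
have [||x dx vx] := @fmap_of_seq_sub ts (domf d) (vals d).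
- by move=> v /Wd; rewrite mem_ts.
- exact: size_vals.
pose H := @Hypergraph C (seq_sub ts) 'I_(size es)
  (fun i => (tnth (in_tuple es) i).1) a x (fun i => proj1 (aP i)).
exists H, val; split; first exact: val_inj.
- apply: perm_trans mE; rewrite /items; apply: perm_cat.
    rewrite /= -[X in perm_eq _ (map _ X)](map_tnth_enum (in_tuple es)) -map_comp.
    by rewrite (eq_map (g := (fun x => (Some x.1, x.2)) \o tnth (in_tuple es))) // => i;
      rewrite /= (proj2 (aP i)).
  rewrite (map_comp (fun v => (None, [:: v])) val); apply: perm_map.
  apply: uniq_perm => //; first by rewrite map_inj_uniq ?enum_uniq //; apply: val_inj.
  move=> v; apply/mapP/idP => [[y _ ->]|vts]; first exact: ssvalP.
  by exists (SeqSub vts); rewrite ?mem_enum.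
- by apply: vals_inj; rewrite ?vals_fcomp ?vx.
Qed.

End Items.

(** * Hyperedge replacement on items *)

Section Replacement.
Variables (C : alphabet) (K : hypergraph C) (e : edge K) (L : hypergraph C).
Hypothesis attL : domf (att e) = htype L.
Hypothesis att_inj : finj (att e).
Hypothesis ext_inj : finj (ext L).

Notation glue := (@glue C K e L).
Notation proj := (@repl_proj C K e L).

Lemma glueP v w :
  reflect (exists s, (att e).[? s] = Some v /\ (ext L).[? s] = Some w)
          (glue (inl v) (inr w)).
Proof.
apply: (iffP existsP) => [[s /andP[/eqP av /eqP ew]]|[s [av]]].
  by exists (val s); rewrite av -ew; case: s {av ew} => s sX; rewrite in_fnd.
case: fndP => // sX [ew]; exists [` sX]; apply/andP; split; first exact/eqP.
by apply/eqP.
Qed.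

Lemma glue_sym : symmetric glue.
Proof. by move=> [v|w] [v'|w']. Qed.

(** Injectivity of the attachment and of the external map leaves each node at most one partner.
    Hence classes have at most two elements and [connect] collapses to equality or a single glue
    step. *)
Lemma glue_glue x y z : glue x y -> glue y z -> x = z.
Proof.
move: x y z => [v|w] [v'|w'] [v2|w2] //.
  move=> /glueP[s [av ew]]; rewrite glue_sym => /glueP[t [av' ew']].
  have st : s = t by apply: finj_fnd ew ew'.
  by move: av'; rewrite -st av => -[->].
rewrite glue_sym => /glueP[s [av ew]] /glueP[t [av' ew']].
have st : s = t by apply: finj_fnd av av'.
by move: ew'; rewrite -st ew => -[->].
Qed.

Lemma connect_glue x y : connect glue x y = (x == y) || glue x y.
Proof.
apply/idP/orP => [/connectP[p]|[/eqP->|/connect1]]; rewrite ?connect0 //.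
elim: p x => [|z p IH] x /=; first by move=> _ ->; left.
case/andP=> xz /IH{}IH /IH[/eqP<-|zy]; first by right.
by left; rewrite (glue_glue xz zy).
Qed.

Lemma repl_proj_glue x y : glue x y -> proj x = proj y.
Proof.
move=> xy; apply: val_inj; apply/setP => z; rewrite !inE.
apply: same_connect (connect1 xy) z; apply: sym_connect_sym; exact: glue_sym.
Qed.

Lemma repl_proj_inj x y : proj x = proj y -> x = y \/ glue x y.
Proof.
move/(congr1 val)/setP/(_ y); rewrite !inE connect0 connect_glue => /orP[/eqP|]; auto.
Qed.

Lemma repl_projP (B : repl_node e L) : exists x, B = proj x.
Proof. by case: B => B pB; have [x _ xB] := imsetP pB; exists x; apply: val_inj. Qed.

Lemma repl_node_lift (f : node K + node L -> var) :
  (forall x y, glue x y -> f x = f y) ->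
  exists nu : repl_node e L -> var, forall x, nu (proj x) = f x.
Proof.
(* Any representative of the class will do; the default 0 is never reached, since classes are
   nonempty. *)
move=> fE; exists (fun B => oapp f 0 [pick x | x \in (sval B : {set _})]) => x.
case: pickP => [y|/(_ x)]; last by rewrite !inE connect0.
by rewrite !inE connect_glue => /orP[/eqP->|/fE].
Qed.

(** The two namings descend to the quotient because they agree on glued nodes; the last hypothesis
    confines coincidences to glued nodes, which gives injectivity. *)
Lemma replace_var (kap : node K -> var) (mu : node L -> var) :
  injective kap -> injective mu -> fcomp kap (att e) = fcomp mu (ext L) ->
  (forall v w, kap v = mu w -> w \in vals (ext L)) ->
  exists nu : node (replace e L) -> var,
    [/\ injective nu, nu \o (proj \o inl) =1 kap
      & nu \o (proj \o inr) =1 mu].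
Proof.
move=> kI mI eA ov.
have fE s : omap kap (att e).[? s] = omap mu (ext L).[? s] by rewrite -!fcompE eA.
have gE v w : glue (inl v) (inr w) -> kap v = mu w.
  by case/glueP=> s [av ew]; have := fE s; rewrite av ew => -[].
have Eg v w : kap v = mu w -> glue (inl v) (inr w).
  move=> vw; have /mem_vals[s ew] := ov _ _ vw; apply/glueP; exists s; split=> //.
  by have := fE s; rewrite ew; case: (_.[? s]) => //= u [uw]; congr Some; apply: kI; rewrite uw.
pose f x := match x with inl v => kap v | inr w => mu w end.
have [|nu nuE] := @repl_node_lift f.
  move=> [v|w] [v'|w'] //; first exact: gE.
  by rewrite glue_sym => /gE.
exists nu; split=> [B B'|v|w]; try by rewrite /= nuE.
have [x ->] := repl_projP B; have [y ->] := repl_projP B'; rewrite !nuE.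
case: x y => [v|w] [v'|w'] /=.
- by move/kI->.
- by move/Eg/repl_proj_glue.
- by move/esym/Eg/repl_proj_glue.
- by move/mI->.
Qed.

Lemma replace_varE (nu : node (replace e L) -> var) : injective nu ->
  let kap := nu \o (proj \o inl) in
  let mu := nu \o (proj \o inr) in
  [/\ injective kap, injective mu & fcomp kap (att e) = fcomp mu (ext L)].
Proof.
move=> nI; split.
- by move=> v v' /nI/repl_proj_inj[[]|].
- by move=> w w' /nI/repl_proj_inj[[]|].
- apply/fmapP => s; rewrite !fcompE.
  have sd : (s \in domf (att e)) = (s \in domf (ext L)) by rewrite attL.
  case: fndP => sa; last by rewrite not_fnd // -sd.
  case: fndP => se /=; last by rewrite -sd sa in se.
  congr (Some (nu _)); apply: repl_proj_glue; apply/glueP.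
  by exists s; rewrite !in_fnd.
Qed.

(** The tokens of nodes attached to [e] are missing: they travel with the hypergraph that is put in
    place of [e]. *)
Definition ctx_items (kap : node K -> var) : seq (option C * seq var) :=
  [seq (Some (lab d), map kap (vals (att d))) | d <- enum (edge K) & d != e] ++
  [seq (None, [:: kap v]) | v <- enum (node K) & v \notin vals (att e)].

Lemma ctx_itemsE kap : perm_eq (items kap)
  ((Some (lab e), map kap (vals (att e))) :: ctx_items kap ++
   [seq (None, [:: kap v]) | v <- vals (att e)]).
Proof.
rewrite /items /ctx_items.
have eE : perm_eq (enum (edge K)) (e :: [seq d <- enum (edge K) | d != e]).
  apply: uniq_perm; rewrite ?enum_uniq //=.
    by rewrite mem_filter eqxx filter_uniq ?enum_uniq.
  by move=> d; rewrite mem_enum in_cons mem_filter mem_enum andbT; case: eqVneq.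
have vE : perm_eq (enum (node K))
    ([seq v <- enum (node K) | v \notin vals (att e)] ++ vals (att e)).
  apply: uniq_perm; rewrite ?enum_uniq //.
    rewrite cat_uniq filter_uniq ?enum_uniq // uniq_vals // andbT /=.
    by apply/hasPn => v vv; rewrite mem_filter vv.
  move=> v; rewrite mem_enum mem_cat mem_filter mem_enum andbT.
  by case: (v \in vals _).
apply: (@perm_trans _ _) (perm_cat (perm_map _ eE) (perm_map _ vE)) _.
by rewrite map_cat /= -catA.
Qed.

(** A glued node is represented by its copy in [L], and every node attached to [e] is glued to one,
    so each node is counted exactly once. *)
Lemma items_replace (nu : node (replace e L) -> var) kap mu :
  nu \o (proj \o inl) =1 kap -> nu \o (proj \o inr) =1 mu ->
  perm_eq (items nu) (ctx_items kap ++ items mu).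
Proof.
move=> nk nm; rewrite /items /ctx_items.
have eE : perm_eq (enum (repl_edge e L))
    (map inl (enum {: {e' : edge K | e' != e}}) ++ map inr (enum (edge L))).
  apply: uniq_perm; rewrite ?enum_uniq //.
    rewrite cat_uniq map_inj_uniq ?enum_uniq; last by move=> ? ? [].
    rewrite map_inj_uniq ?enum_uniq; last by move=> ? ? [].
    by rewrite andbT; apply/hasPn => _ /mapP[d _ ->]; apply/mapP => -[].
  move=> [d|d]; rewrite mem_enum mem_cat; apply/esym/orP.
    by left; rewrite map_f ?mem_enum.
  by right; rewrite map_f ?mem_enum.
have vE : perm_eq (enum (repl_node e L))
    (map (proj \o inl) [seq v <- enum (node K) | v \notin vals (att e)] ++
     map (proj \o inr) (enum (node L))).
  apply: uniq_perm; rewrite ?enum_uniq //.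
    have il : injective (proj \o inl) by move=> w w' /repl_proj_inj[[]|].
    have ir : injective (proj \o inr) by move=> w w' /repl_proj_inj[[]|].
    rewrite cat_uniq (map_inj_uniq il) (map_inj_uniq ir) enum_uniq andbT.
    rewrite (filter_uniq _ (enum_uniq _)) /=; apply/hasPn => _ /mapP[w _ ->]; apply/mapP => -[v].
    rewrite mem_filter => /andP[vv _] /repl_proj_inj[//|].
    rewrite glue_sym => /glueP[s [av _]]; case/negP: vv.
    by apply/mem_vals; exists s.
  move=> B; rewrite mem_enum mem_cat; apply/esym/orP.
  have [[v|w] ->] := repl_projP B; last by right; apply/mapP; exists w; rewrite ?mem_enum.
  case: (boolP (v \in vals (att e))) => [|vv].
    case/mem_vals=> s av; right.
    have sX : s \in domf (ext L) by rewrite -[domf _]attL -fndSome av.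
    apply/mapP; exists ((ext L).[sX]%fmap); rewrite ?mem_enum //=.
    by apply: repl_proj_glue; apply/glueP; exists s; split=> //; exact: in_fnd.
  by left; apply/mapP; exists v; rewrite // mem_filter vv mem_enum.
have subE : perm_eq (map val (enum {: {e' : edge K | e' != e}}))
    [seq d <- enum (edge K) | d != e].
  apply: uniq_perm; first by rewrite (map_inj_uniq val_inj) enum_uniq.
    by rewrite filter_uniq ?enum_uniq.
  move=> d; rewrite mem_filter mem_enum andbT; apply/mapP/idP => [[d' _ ->]|de].
    exact: valP d'.
  by exists (Sub d de); rewrite ?mem_enum ?SubK.
apply: perm_trans (perm_cat (perm_map _ eE) (perm_map _ vE)) _.
set F := fun d : repl_edge e L => _; set G := fun B : repl_node e L => _.
set A := fun d : edge K => (Some (lab d), _); set A' := fun v : node K => (None, _).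
set B := fun d : edge L => _; set B' := fun w : node L => _.
have -> : map F (map inl (enum {: {e' : edge K | e' != e}}) ++ map inr (enum (edge L))) =
          map A (map val (enum {: {e' : edge K | e' != e}})) ++ map B (enum (edge L)).
  rewrite map_cat -(map_comp A val) -(map_comp F inl) -(map_comp F inr).
  by congr cat; apply: eq_map => d; rewrite /A /B /F /=; congr pair;
    rewrite vals_fcomp -map_comp; apply: eq_map.
rewrite (map_cat G) -(map_comp G (proj \o inl)) -(map_comp G (proj \o inr)).
rewrite (@eq_map _ _ (G \o (proj \o inl)) A'); last first.
  by move=> v; rewrite /A' -nk.
rewrite (@eq_map _ _ (G \o (proj \o inr)) B'); last first.
  by move=> w; rewrite /B' -nm.
have pA := perm_map A subE.
permut.
Qed.

End Replacement.

(** * Derivation steps on items *)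

Lemma iso_refl (C : alphabet) (H : hypergraph C) : iso H H.
Proof.
exists id, id; split=> //; try by exists id.
- by move=> e; rewrite fcomp_id.
- by rewrite fcomp_id.
Qed.

Lemma iso_trans (C : alphabet) (H1 H2 H3 : hypergraph C) :
  iso H1 H2 -> iso H2 H3 -> iso H1 H3.
Proof.
case=> f [g [fB gB gl ga ge]] [f' [g' [fB' gB' gl' ga' ge']]].
exists (f' \o f), (g' \o g); split; try exact: bij_comp.
- by move=> e /=; rewrite gl' gl.
- by move=> e /=; rewrite ga' ga fcomp_comp.
- by rewrite ge' ge fcomp_comp.
Qed.

Lemma iso_sym (C : alphabet) (H1 H2 : hypergraph C) : iso H1 H2 -> iso H2 H1.
Proof.
case=> f [g [[f' fK fK'] [g' gK gK'] gl ga ge]]; exists f', g'; split.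
- by exists f.
- by exists g.
- by move=> e; rewrite -gl gK'.
- move=> e; rewrite -{2}(gK' e) ga fcomp_comp -[LHS]fcomp_id.
  by apply: eq_fcomp => v /=; rewrite fK.
- rewrite ge fcomp_comp -[LHS]fcomp_id.
  by apply: eq_fcomp => v /=; rewrite fK.
Qed.

Lemma iso_lift_hole (C : alphabet) X (H H' : hypergraph C) :
  iso H H' -> iso (lift_hole X H) (lift_hole X H').
Proof. by case=> f [g [fB gB gl ga ge]]; exists f, g; split=> // e /=; rewrite gl. Qed.

Lemma iso_items (C : alphabet) (H H' : hypergraph C) (nu' : node H' -> var) :
  iso H H' -> injective nu' ->
  exists nu : node H -> var,
    [/\ injective nu, perm_eq (items nu) (items nu')
      & fcomp nu (ext H) = fcomp nu' (ext H')].
Proof.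
case=> f [g [fB gB gl ga ge]] nI; exists (nu' \o f); split.
- exact: inj_comp nI (bij_inj fB).
- have bijE (A B : finType) (h : A -> B) : bijective h -> perm_eq (map h (enum A)) (enum B).
    move=> hB; apply: uniq_perm; rewrite ?(map_inj_uniq (bij_inj hB)) ?enum_uniq //.
    case: hB => h' hK hK' b; rewrite mem_enum; apply/mapP.
    by exists (h' b); rewrite ?mem_enum.
  have pe := perm_map (fun e => (Some (lab e), map nu' (vals (att e)))) (bijE _ _ _ gB).
  have pv := perm_map (fun v => (None : option C, [:: nu' v])) (bijE _ _ _ fB).
  apply: perm_trans (perm_cat pe pv); rewrite /items.
  rewrite -(map_comp (fun e => (Some (lab e), map nu' (vals (att e)))) g).
  rewrite -(map_comp (fun v => (None : option C, [:: nu' v])) f).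
  rewrite perm_cat2r; under eq_map => e do rewrite map_comp -vals_fcomp -ga -gl.
  exact: perm_refl.
- by rewrite ge fcomp_comp.
Qed.

Section Lift.
Variables (C : alphabet) (X : {fset var}).

Definition up (x : option C * seq var) : option (with_hole C X) * seq var :=
  (omap Some x.1, x.2).

(** On a hole the value is an arbitrary default: [down] is only applied to multisets made of images
    of [up]. *)
Definition down (x : option (with_hole C X) * seq var) : option C * seq var :=
  (obind id x.1, x.2).

Lemma upK : cancel up down.
Proof. by case=> -[c|] xs. Qed.

Lemma items_lift (H : hypergraph C) (nu : node H -> var) :
  @items _ (lift_hole X H) nu = map up (items nu).
Proof. by rewrite /items map_cat -!map_comp. Qed.

Lemma toks_up m : toks (map up m) = toks m.
Proof. by rewrite /toks filter_map -map_comp; congr map; apply: eq_filter => -[[]]. Qed.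

End Lift.

Section Steps.
Variables (C : alphabet) (S : ht_system C).

Lemma ht_step_isoL G1 G2 G3 : iso G1 G2 -> ht_step S G2 G3 -> ht_step S G1 G3.
Proof.
move=> i12 [r [rS [K [e [da ia i2 i3]]]]]; exists r; split=> //; exists K, e; split=> //.
exact: iso_trans (iso_lift_hole _ i12) i2.
Qed.

Lemma ht_steps_rcons n G1 G2 G3 :
  ht_steps S n G1 G2 -> ht_step S G2 G3 -> ht_steps S n.+1 G1 G3.
Proof.
elim=> [{}G1 {}G2 i12|m {}G1 G {}G2 s1 _ IH] s.
  by apply: ht_stepsS (ht_step_isoL i12 s) (ht_steps0 _ (iso_refl _)).
exact: ht_stepsS s1 (IH s).
Qed.

Lemma ht_steps_isoR n G1 G2 G3 : ht_steps S n G1 G2 -> iso G2 G3 -> ht_steps S n G1 G3.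
Proof.
elim=> [{}G1 {}G2 i12|m {}G1 G {}G2 s1 _ IH] i23.
  exact: ht_steps0 (iso_trans i12 i23).
exact: ht_stepsS s1 (IH i23).
Qed.

Lemma ht_step_htype G1 G2 : ht_step S G1 G2 -> htype G2 = htype G1.
Proof.
case=> r [_ [K [e [_ _ [f1 [g1 [_ _ _ _ e1]]] [f2 [g2 [_ _ _ _ e2]]]]]]].
have := congr1 (fun a : {fmap var -> _} => domf a) e1; rewrite /htype /= => <-.
by have := congr1 (fun a : {fmap var -> _} => domf a) e2; rewrite /htype /= => <-.
Qed.

Lemma iso_htype (H H' : hypergraph C) : iso H H' -> htype H' = htype H.
Proof. by case=> f [g [_ _ _ _ e]]; rewrite /htype e. Qed.

Lemma ht_steps_htype n G1 G2 : ht_steps S n G1 G2 -> htype G2 = htype G1.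
Proof. by elim=> [?? /iso_htype|? ??? /ht_step_htype <- _ ->]. Qed.

(** Read from [G2] back to [G1], the way the sequent is built up. The naming [mu'] of the left-hand
    side is arbitrary up to freshness, because its inner nodes will be named by eigenvariables. *)
Lemma ht_step_items G1 G2 : ht_step S G1 G2 ->
  exists r, List.In r (rules S) /\
  forall nu2 : node G2 -> var, injective nu2 ->
  exists (a : seq (option C * seq var)) (F : seq var) (mu : node (rhs r) -> var),
    [/\ injective mu, perm_eq (items nu2) (a ++ items mu) &
     forall mu' : node (lhs r) -> var, injective mu' ->
       fcomp mu' (ext (lhs r)) = fcomp mu (ext (rhs r)) ->
       (forall w, w \notin vals (ext (lhs r)) -> mu' w \notin F) ->
       exists nu1 : node G1 -> var,
         [/\ injective nu1, perm_eq (items nu1) (a ++ items mu')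
           & fcomp nu1 (ext G1) = fcomp nu2 (ext G2)]].
Proof.
case=> r [rS [K [e [da ia i1 i2]]]]; exists r; split=> // nu2 nI2.
have li := @lhs_inj _ r; have ri := @rhs_inj _ r.
have dal : domf (att e) = htype (lift_hole (htype (lhs r)) (lhs r)) by [].
have dar : domf (att e) = htype (lift_hole (htype (lhs r)) (rhs r)) by rewrite da rule_type.
have [nu [nI np ne]] := @iso_items _ _ (lift_hole (htype (lhs r)) G2) nu2 (iso_sym i2) nI2.
rewrite items_lift in np.
have [kI mI eE] := replace_varE dar ia ri nI.
have np' := items_replace dar ia ri (frefl _) (frefl _) : perm_eq (items nu) _.
set kap := nu \o _ in kI eE np'; set mu := nu \o _ in mI eE np'.
(* [F] consists of the variables of all context nodes, so that new inner nodes collide with none of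
   them. *)
exists (map (@down _ _) (ctx_items e kap)), (map kap (enum (node K))), mu; split=> //.
  rewrite -(mapK (@upK C (htype (lhs r))) (items nu2)) -(mapK (@upK C (htype (lhs r))) (@items C (rhs r) mu)).
  rewrite -map_cat perm_map //; rewrite items_lift in np'.
  by apply: perm_trans np'; rewrite perm_sym.
move=> mu' mI' eE' mF.
have [||nu' [nI' nk nm]] := @replace_var _ K e (lift_hole (htype (lhs r)) (lhs r)) ia li kap mu' kI mI'.
- by rewrite eE eE'.
- move=> v w vw; apply: contraT => /mF; rewrite -vw map_f ?mem_enum //.
have np2 := items_replace dal ia li nk nm.
have [nu1 [nI1 np1 ne1]] := iso_items i1 nI'; exists nu1; split=> //.
  rewrite -(mapK (@upK C (htype (lhs r))) (@items C G1 nu1)) -(mapK (@upK C (htype (lhs r))) (@items C (lhs r) mu')).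
  rewrite -map_cat perm_map //; rewrite !items_lift in np1 np2.
  exact: perm_trans np1 np2.
rewrite ne1 -ne /= !fcomp_comp; apply: eq_fcomp => v.
exact: nk.
Qed.

(** No context is given: it is rebuilt from its items by [wf_items_graph]. The two freshness
    hypotheses are the dangling condition: no item of [a] and no external node of [G] refers to a
    node that the rule deletes. *)
Lemma items_ht_step r G (nu : node G -> var) (mu : node (lhs r) -> var)
    (mu' : node (rhs r) -> var) a :
  List.In r (rules S) -> injective nu -> injective mu ->
  perm_eq (items nu) (a ++ items mu) ->
  fcomp mu (ext (lhs r)) = fcomp mu' (ext (rhs r)) ->
  uniq (toks (a ++ items mu')) ->
  (forall w x, w \notin vals (ext (lhs r)) -> x \in a -> mu w \notin x.2) ->
  (forall w, w \notin vals (ext (lhs r)) -> mu w \notin vals (fcomp nu (ext G))) ->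
  exists G' (nu' : node G' -> var),
    [/\ injective nu', perm_eq (items nu') (a ++ items mu'),
        fcomp nu' (ext G') = fcomp nu (ext G) & ht_step S G G'].
Proof.
move=> rS nI mI p eX u' fa fd.
have li := @lhs_inj _ r; have ri := @rhs_inj _ r.
have rt := rule_type r.
pose dv := vals (fcomp mu (ext (lhs r))).
pose X := htype (lhs r).
have [u W] := perm_wf_items p (items_wf nI).
have toksE (L : hypergraph C) (lam : node L -> var) v :
    ([:: v] \in toks (a ++ items lam)) =
    ([:: v] \in toks a) || (v \in map lam (enum (node L))).
  rewrite toks_cat mem_cat toks_items; congr orb.
  by rewrite (map_comp (fun v => [:: v]) lam) mem_map // => ? ? [].
have [u1 u2 u3] := uniq_toks_items u'.
have dvE v : v \in dv -> exists w, v = mu' w /\ w \in vals (ext (rhs r)).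
  by rewrite /dv eX vals_fcomp => /mapP[w we ->]; exists w.
(* A variable that is carried by no inner node of the left-hand side keeps its token, so whatever is
   attached to it survives the step. *)
have old v : (forall w, w \notin vals (ext (lhs r)) -> mu w != v) ->
    [:: v] \in toks (a ++ items mu) -> ([:: v] \in toks a) || (v \in dv).
  move=> vf; rewrite toksE => /orP[->//|/mapP[w _ vw]]; apply/orP; right.
  rewrite /dv vals_fcomp vw map_f //; apply: contraT => /vf; by rewrite vw eqxx.
have old_dv v : ([:: v] \in toks a) || (v \in dv) -> [:: v] \in toks (a ++ items mu').
  rewrite toksE => /orP[->//|/dvE[w [-> _]]].
  by rewrite map_f ?orbT ?mem_enum.
have fav w x v : w \notin vals (ext (lhs r)) -> x \in a -> v \in x.2 -> mu w != v.
  by move=> we xa vx; apply/eqP => e; move: (fa _ _ we xa); rewrite e vx.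
have W' : wf_items (a ++ items mu').
  split=> // x; rewrite mem_cat => /orP[xa|xi].
    have := W x; rewrite mem_cat xa => /(_ isT); case: x xa => -[c|] xs //= xa [sz sub].
    by split=> // v vx; apply: old_dv; apply: old (sub _ vx) => w we; exact: fav xa vx.
  have := (items_wf u2).2 x xi; case: x {xi} => -[c|] xs //= [sz sub]; split=> // v /sub.
  by rewrite toks_cat mem_cat => ->; rewrite orbT.
have dE v : v \in vals (fcomp nu (ext G)) -> ([:: v] \in toks a) || (v \in dv).
  move=> vd; apply: old => [w we|]; first by apply/eqP => e; move: (fd _ we); rewrite e vd.
  rewrite -(perm_mem (perm_toks p)) toks_items; move: vd; rewrite vals_fcomp => /mapP[z _ ->].
  by rewrite (map_f (fun v => [:: nu v])) ?mem_enum.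
have [G' [nu' [nI' p' ed']]] := wf_items_graph W' (fun v vd => old_dv _ (dE v vd)).
exists G', nu'; split=> //.
(* Items of the context: the hole, those of [a], and the tokens of the rule's external nodes, which
   [a] lacks because they belong to [items mu]. *)
pose mK : seq (option (with_hole C X) * seq var) :=
  (Some None, dv) :: map (@up C X) (a ++ [seq (None, [:: v]) | v <- dv]).
have tK : toks mK = toks a ++ [seq [:: v] | v <- dv].
  rewrite -[toks mK]/(toks (map (@up C X) _)) toks_up toks_cat; congr cat.
  by rewrite /toks filter_map (eq_filter (a2 := predT)) // filter_predT -map_comp.
have dvu : uniq dv by rewrite /dv eX uniq_vals //; apply: finj_fcomp.
have mem_tK v : ([:: v] \in toks mK) = ([:: v] \in toks a) || (v \in dv).
  by rewrite tK mem_cat mem_map // => ? ? [].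
have WK : wf_items mK.
  split.
    rewrite tK cat_uniq u1 map_inj_uniq ?dvu ?andbT; last by move=> ? ? [].
    by apply/hasPn => _ /mapP[v /dvE[w [-> _]] ->].
  move=> x; rewrite inE => /orP[/eqP->|/mapP[y ya ->]] /=.
    by split; [rewrite size_vals|move=> v vd; rewrite mem_tK vd orbT].
  move: ya; rewrite mem_cat => /orP[ya|/mapP[v _ ->]]; last by exists v.
  have := W y; rewrite mem_cat ya => /(_ isT); case: y ya => -[c|] xs //= ya [sz sub].
  by split=> // v vx; rewrite mem_tK; apply: old (sub _ vx) => w we; exact: fav ya vx.
have [v /dE|K [kap [kI pK eK]]] := wf_items_graph (d := fcomp nu (ext G)) WK.
  by rewrite mem_tK.
have [e [le ve]] : exists e : edge K, lab e = None /\ map kap (vals (att e)) = dv.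
  have : (Some None, dv) \in items kap by rewrite (perm_mem pK) mem_head.
  rewrite mem_cat => /orP[/mapP[e _ [le ve]]|/mapP[? _ []//]].
  by exists e.
have da : domf (att e) = X by rewrite att_dom le.
have ia : finj (att e).
  by apply: uniq_vals_finj; apply: (@map_uniq _ _ kap); rewrite ve.
have eA : fcomp kap (att e) = fcomp mu (ext (lhs r)).
  by apply: vals_inj; rewrite // vals_fcomp ve.
have pc : perm_eq (ctx_items e kap) (map (@up C X) a).
  rewrite -(perm_cat2r (map (@up C X) [seq (None, [:: v]) | v <- dv])) -map_cat.
  rewrite -(perm_cons (Some None, dv)) -/mK; apply: perm_trans pK.
  rewrite perm_sym; apply: perm_trans (ctx_itemsE ia kap) _.
  by rewrite le ve -ve -!map_comp.
(* One argument for both sides of the rule, plugged into the same context: the left-hand side gives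
   [G], the right-hand side [G']. *)
have replE (L : hypergraph C) (lam : node L -> var) : domf (ext L) = X -> finj (ext L) ->
    injective lam -> fcomp lam (ext L) = fcomp mu (ext (lhs r)) ->
    uniq (toks (a ++ items lam)) ->
    forall G (nu : node G -> var), injective nu -> perm_eq (items nu) (a ++ items lam) ->
    fcomp nu (ext G) = fcomp kap (ext K) ->
    iso (lift_hole X G) (replace e (lift_hole X L)).
  move=> dL iL lI eL uL G0 nu0 nI0 p0 e0.
  have dal : domf (att e) = htype (lift_hole X L) by rewrite da.
  have [||nu1 [nI1 nk nl]] := @replace_var _ K e (lift_hole X L) ia iL kap lam kI lI.
  - by rewrite eA -eL.
  (* A context node shares a variable with [L] only through [dv]: a shared token in [a] would make
     two tokens of [a ++ items lam] equal. *)
  - move=> v w vw.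
    have : [:: kap v] \in toks mK.
      by rewrite -(perm_mem (perm_toks pK)) toks_items (map_f (fun v => [:: kap v])) ?mem_enum.
    rewrite mem_tK vw => /orP[ta|]; last by rewrite /dv -eL vals_fcomp mem_map.
    by have [_ _ /(_ w)] := uniq_toks_items uL; rewrite ta.
  have p1 := items_replace dal ia iL nk nl.
  apply: (@items_iso _ _ _ (nu0 : node (lift_hole X G0) -> var) nu1 nI0 nI1).
    rewrite !items_lift in p1 *; apply: perm_trans (perm_map _ p0) _.
    by rewrite map_cat perm_sym; apply: perm_trans p1 _; rewrite perm_cat2r.
  rewrite /= e0 !fcomp_comp; apply: eq_fcomp => v.
  by rewrite -nk.
exists r; split=> //; exists K, e; split=> //.
  exact: (replE _ mu _ li mI _ _ _ nu).
by apply: (replE _ mu' _ ri u2 _ _ _ nu') => //; rewrite ?ed'.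
Qed.

End Steps.

(** * Hypergraphs as formulas *)

Section Naming.
Variables (C : alphabet) (L : hypergraph C).
Hypothesis ext_inj : finj (ext L).

(* An external node is named by its selector. *)
Definition name (v : node L) : var :=
  if [pick s : domf (ext L) | ext L s == v] is Some s then val s
  else (fresh_var (htype L) + enum_rank v)%N.

Definition inner : seq var :=
  [seq name v | v <- enum (node L) & v \notin vals (ext L)].

Lemma name_ext s v : (ext L).[? s] = Some v -> name v = s.
Proof.
move=> sv; rewrite /name; case: pickP => [t /eqP tv|/= none].
  by apply: finj_fnd sv; rewrite -?tv -?Some_fnd.
by move: sv; case: fndP => // sX [sv]; have := none [` sX]; rewrite sv eqxx.
Qed.

Lemma name_inner v : v \notin vals (ext L) -> name v = (fresh_var (htype L) + enum_rank v)%N.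
Proof.
move=> vv; rewrite /name; case: pickP => // t /eqP tv; case/negP: vv.
by apply/mem_vals; exists (val t); rewrite -tv Some_fnd.
Qed.

Lemma name_mem v : v \in vals (ext L) -> name v \in htype L.
Proof. by case/mem_vals=> s sv; rewrite (name_ext sv) /htype -fndSome sv. Qed.

(** Inner names exceed the sum of all selectors, hence each selector. *)
Lemma name_inner_notin v : v \notin vals (ext L) -> name v \notin htype L.
Proof.
move=> /name_inner ->; apply/negP => /(@leq_sumn (htype L)).
by rewrite /fresh_var addSn ltnNge leq_addr.
Qed.

Lemma name_inj : injective name.
Proof.
move=> v w vw.
have vE : (v \in vals (ext L)) = (w \in vals (ext L)).
  apply/idP/idP => [/name_mem|/name_mem].
    by rewrite vw; apply: contraLR; exact: name_inner_notin.
  by rewrite -vw; apply: contraLR; exact: name_inner_notin.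
case: (boolP (v \in vals (ext L))) => vX; move: (vX); rewrite vE => wX.
  have /mem_vals[s sv] := vX; have /mem_vals[t tw] := wX.
  have st : s = t by rewrite -(name_ext sv) vw (name_ext tw).
  by move: tw; rewrite -st sv => -[].
by move: vw; rewrite !name_inner // => /addnI/ord_inj/enum_rank_inj.
Qed.

Lemma inner_uniq : uniq inner.
Proof. by rewrite (map_inj_uniq name_inj) filter_uniq ?enum_uniq. Qed.

Lemma inner_notin z : z \in htype L -> z \notin inner.
Proof.
move=> zX; apply/mapP => -[v]; rewrite mem_filter => /andP[vX _] zv.
by move: (name_inner_notin vX); rewrite -zv zX.
Qed.

Lemma name_in_inner v : v \notin vals (ext L) -> name v \in inner.
Proof. by move=> vX; rewrite map_f // mem_filter vX mem_enum. Qed.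

Lemma fcomp_name (g : var -> var) s :
  (fcomp (g \o name) (ext L)).[? s] = if s \in htype L then Some (g s) else None.
Proof.
rewrite fcompE; case: (boolP (s \in htype L)) => sX; last by rewrite not_fnd.
by case: fndP => [sX'|] /=; [rewrite (@name_ext s) // in_fnd|rewrite sX].
Qed.

End Naming.

Section Encoding.
Variables (C : alphabet) (D : {fset C}).

(* Predicate symbols: 0 is the final proposition, 1 marks nodes, and the labels
   in [D] follow. *)
Definition enc (x : option C) : nat := if x is Some c then (index c D).+2 else 1.

(** All labels outside [D] share one code, so [enc] is injective only on known symbols. *)
Definition known (x : option C) : bool := if x is Some c then c \in D else true.

Lemma enc_inj x y : known x -> known y -> enc x = enc y -> x = y.
Proof.
case: x y => [c|] [c'|] //= cD cD' [e]; congr Some.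
by rewrite -(nth_index c cD) e nth_index.
Qed.

Definition goal_fm : formula := Atom 0 [::].

Definition item_fm (x : option C * seq var) : formula := Atom (enc x.1) x.2.

Definition ren_item (g : var -> var) (x : option C * seq var) := (x.1, map g x.2).

Lemma items_ren (L : hypergraph C) (nu : node L -> var) g :
  items (g \o nu) = map (ren_item g) (items nu).
Proof.
rewrite /items map_cat -(map_comp (ren_item g) (fun v => (None, [:: nu v]))).
rewrite -(map_comp (ren_item g) (fun e => (Some (lab e), map nu (vals (att e))))).
by congr cat; apply: eq_map => e /=; rewrite /ren_item /= -map_comp.
Qed.

(* [exists inner. items] is encoded in continuation-passing style, since the
   empty hypergraph would need a unit, which MILL1 does not have. *)
Definition cont (L : hypergraph C) : formula :=
  foralls (inner L) (lollis (map item_fm (items (@name C L))) goal_fm).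

(** [cont] is a negation with respect to [goal_fm], so this is the contrapositive of turning the
    right-hand side into the left-hand side. Quantifying over the selectors lets the external nodes
    be any variables. *)
Definition rule_fm (r : ht_rule C) : formula :=
  foralls (htype (lhs r)) (Lolli (cont (lhs r)) (cont (rhs r))).

Lemma map_fm_lollis (g : var -> var) xs :
  map_fm g (lollis (map item_fm xs) goal_fm) =
  lollis (map item_fm (map (ren_item g) xs)) goal_fm.
Proof. by elim: xs => //= x xs ->. Qed.

Lemma fvar_cont (L : hypergraph C) : finj (ext L) -> {subset fvar (cont L) <= htype L}.
Proof.
move=> iL z; rewrite fvar_foralls => /andP[zi zf].
have [v zv] : exists v : node L, z = name v.
  suff : exists2 x, x \in items (@name C L) & z \in x.2.
    case=> x; rewrite mem_cat => /orP[/mapP[e _ ->]|/mapP[v _ ->]] /=.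
      by case/mapP=> v _ ->; exists v.
    by rewrite inE => /eqP->; exists v.
  elim: (items _) zf => //= x xs IH; rewrite mem_cat => /orP[zx|/IH[y yx zy]].
    by exists x; rewrite ?mem_head.
  by exists y; rewrite // inE yx orbT.
apply: contraR zi => zX; rewrite zv; apply: name_in_inner.
by apply: contra zX; rewrite zv => /(name_mem iL).
Qed.

Lemma fvar_rule (r : ht_rule C) : fvar (rule_fm r) = [::].
Proof.
case E: (fvar _) => [//|z s].
have : z \in fvar (rule_fm r) by rewrite E mem_head.
rewrite fvar_foralls /= mem_cat => /andP[zX].
by case/orP=> /fvar_cont; [move/(_ (@lhs_inj _ r))|move/(_ (@rhs_inj _ r)); rewrite -rule_type];
  rewrite (negPf zX).
Qed.

Lemma derivable_contL (L : hypergraph C) (g : var -> var) (mu : node L -> var) :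
  finj (ext L) -> (forall s v, (ext L).[? s] = Some v -> mu v = g s) ->
  derivable (map_fm g (cont L) :: map item_fm (items mu)) goal_fm.
Proof.
move=> iL mg.
(* The bound names of inner nodes are instantiated by the actual variables of these nodes. *)
pose g' z := if [pick v | @name C L v == z] is Some v then mu v else g z.
have gn v : g' (name v) = mu v.
  rewrite /g'; case: pickP => [w /eqP /(name_inj iL)->//|/(_ v)].
  by rewrite eqxx.
apply: (@derivable_forallsL _ _ _ _ _ g').
  move=> z; rewrite inE /g'; case: pickP => // v /eqP <- vi.
  case: (boolP (v \in vals (ext L))) => [/mem_vals[s sv]|vX]; last first.
    by case/negP: vi; exact: name_in_inner.
  by rewrite (mg _ _ sv) (name_ext iL sv).
rewrite map_fm_lollis -items_ren.
have -> : items mu = items (g' \o @name C L).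
  by rewrite /items; congr cat; apply: eq_map => e /=; rewrite ?gn //; congr pair;
    apply: eq_map => v /=; rewrite gn.
exact: derivable_lollisL.
Qed.

Lemma derivable_contR (L : hypergraph C) (g : var -> var) G (F : seq var) :
  finj (ext L) ->
  (forall mu : node L -> var,
     (forall s v, (ext L).[? s] = Some v -> mu v = g s) ->
     {in predC (mem (vals (ext L))) &, injective mu} ->
     (forall v, v \notin vals (ext L) -> mu v \notin F) ->
     derivable (G ++ map item_fm (items mu)) goal_fm) ->
  derivable G (map_fm g (cont L)).
Proof.
move=> iL dG; apply: (@derivable_forallsR _ _ _ _ F (inner_uniq iL)) => g' E gI gF.
rewrite map_fm_lollis -items_ren; apply: derivable_lollisR; apply: dG.
- move=> s v sv; rewrite /= (name_ext iL sv) E //.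
  by rewrite inE inner_notin // /htype -fndSome sv.
- move=> v w vX wX /= /gI; rewrite !name_in_inner // => /(_ isT isT).
  exact: name_inj.
- by move=> v vX; apply: gF; apply: name_in_inner.
Qed.

Definition load (A : formula) (Rs : seq formula) : formula :=
  foldr (fun R B => Tensor B R) A Rs.

Lemma derivable_load A Rs G B : derivable (A :: Rs ++ G) B -> derivable (load A Rs :: G) B.
Proof.
elim: Rs G => //= R Rs IH G dB; apply: d_tensorL; apply: IH.
by apply: d_perm dB; permut.
Qed.

Lemma derivable_loads (T : Type) (s : seq T) (A : T -> formula) (Rs : T -> seq formula) G B :
  derivable (map A s ++ flatten (map Rs s) ++ G) B ->
  derivable ([seq load (A x) (Rs x) | x <- s] ++ G) B.
Proof.
elim: s G => //= x s IH G dB; apply: derivable_load.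
apply: (@d_perm ([seq load (A x) (Rs x) | x <- s] ++ A x :: Rs x ++ G)); first by permut.
by apply: IH; apply: d_perm dB; permut.
Qed.

(** The bound [k] on the number of attached formulas is what keeps the lexicon a finite list. *)
Fixpoint loads (Rf : seq formula) (k : nat) (A : formula) : seq formula :=
  if k is k.+1 then A :: [seq Tensor B R | B <- loads Rf k A, R <- Rf] else [:: A].

Lemma mem_loads Rf k A Rs :
  size Rs <= k -> {subset Rs <= Rf} -> load A Rs \in loads Rf k A.
Proof.
elim: Rs k => [|R Rs IH] [|k] //=; rewrite ?inE ?eqxx // => sz sub; apply/orP; right.
apply/allpairsP; exists (load A Rs, R); split=> //=.
  by apply: IH => // x xR; apply: sub; rewrite inE xR orbT.
by apply: sub; rewrite mem_head.
Qed.

Lemma loadsP Rf k A B :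
  B \in loads Rf k A -> exists2 Rs, {subset Rs <= Rf} & B = load A Rs.
Proof.
elim: k B => [|k IH] B /=; first by rewrite inE => /eqP->; exists [::].
rewrite inE => /orP[/eqP->|/allpairsP[[B' R] /= [/IH[Rs sub ->] RR ->]]]; first by exists [::].
exists (R :: Rs) => // x; rewrite inE => /orP[/eqP->//|]; exact: sub.
Qed.

Lemma fvar_load A Rs : (forall R, R \in Rs -> fvar R = [::]) -> fvar (load A Rs) = fvar A.
Proof.
elim: Rs => //= R Rs IH cl; rewrite IH => [|x xR].
  by rewrite (cl R) ?mem_head // cats0.
by apply: cl; rewrite inE xR orbT.
Qed.

Lemma subst_load h A Rs : (forall R, R \in Rs -> fvar R = [::]) ->
  subst h (load A Rs) = load (subst h A) Rs.
Proof.
elim: Rs => //= R Rs IH cl; rewrite -IH => [|x xR]; last by apply: cl; rewrite inE xR orbT.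
rewrite /subst /=; congr Tensor; rewrite -[RHS](@map_fm_id _ _ id) //.
by apply: map_fm_eq_in => x; rewrite cl ?mem_head.
Qed.

End Encoding.

(** Greedy: each element of [s] takes the next [k] entries of [xs]. As [s] is duplicate-free, the
    choice for one element can be set without disturbing the others. *)
Lemma distribute (T T' : eqType) (s : seq T) (xs : seq T') k :
  uniq s -> size xs <= k * size s ->
  exists ch : T -> seq T',
    (forall x, size (ch x) <= k) /\ flatten (map ch s) = xs.
Proof.
elim: s xs => [|x s IH] xs /=; first by rewrite muln0 leqn0 size_eq0 => _ /eqP->; exists (fun=> [::]).
case/andP=> xs' us sz; have [|ch [chk chE]] := IH (drop k xs) us.
  by rewrite size_drop leq_subLR -mulnS.
exists (fun y => if y == x then take k xs else ch y); split.
  by move=> y; case: eqP => // _; rewrite size_take; case: ltnP.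
rewrite eqxx -[RHS](cat_take_drop k) -chE; congr (_ ++ flatten _).
by apply/eq_in_map => y ys; case: eqP => // yx; move: xs'; rewrite -yx ys.
Qed.

Lemma map_sel_type (a : {fmap var -> var}) (X : {fset var}) :
  domf a = X -> map (fun x => odflt x a.[? x]) X = vals a.
Proof.
move=> <-; rewrite /vals.
have : {subset enum_fset (domf a) <= domf a} by [].
elim: (enum_fset _) => //= s l IH sub; rewrite IH; last by move=> t tl; apply: sub; rewrite inE tl orbT.
by rewrite in_fnd ?sub ?mem_head.
Qed.

Section Grammar.
Variables (C : alphabet) (S : ht_system C).

Definition symbols : {fset C} := nonterm S `|` term S.

Notation item_fm := (item_fm symbols).
Notation cont := (cont symbols).
Notation rule_fm := (rule_fm symbols).
Notation goal := goal_fm.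

Definition rule_fms : seq formula := map rule_fm (rules S).

Lemma mem_rule_fms R :
  R \in rule_fms -> exists2 r, List.In r (rules S) & R = rule_fm r.
Proof.
rewrite /rule_fms; elim: (rules S) => //= r rs IH; rewrite inE => /orP[/eqP->|/IH[r' rr ->]].
  by exists r; [left|].
by exists r'; [right|].
Qed.

Lemma rule_fm_in r : List.In r (rules S) -> rule_fm r \in rule_fms.
Proof.
rewrite /rule_fms; elim: (rules S) => //= r' rs IH [->|/IH]; rewrite inE ?eqxx // => ->.
by rewrite orbT.
Qed.

Lemma rule_fms_closed R : R \in rule_fms -> fvar R = [::].
Proof. by case/mem_rule_fms=> r _ ->; apply: fvar_rule. Qed.

(** * Completeness *)

(** Quantifying over all namings with external part [d] carries the induction along a derivation,
    where inner nodes receive eigenvariables that are not known in advance. *)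
Definition proves G (d : {fmap var -> var}) Delta : Prop :=
  forall nu : node G -> var, injective nu -> fcomp nu (ext G) = d ->
    derivable (map item_fm (items nu) ++ Delta) goal.

Lemma ht_step_proves G1 G2 : ht_step S G1 G2 ->
  exists2 R, R \in rule_fms &
    forall d Delta, proves G1 d Delta -> proves G2 d (R :: Delta).
Proof.
case/ht_step_items=> r [rS H]; exists (rule_fm r); first exact: rule_fm_in.
move=> d Delta d1 nu2 nI2 e2; have [a [F [mu [mI p2 Hmu]]]] := H nu2 nI2.
have li := @lhs_inj _ r; have ri := @rhs_inj _ r.
pose b := fcomp mu (ext (rhs r)).
pose g z := odflt z b.[? z].
have gE s v : (ext (rhs r)).[? s] = Some v -> mu v = g s.
  by move=> sv; rewrite /g /b fcompE sv.
apply: (@d_perm (rule_fm r :: (map item_fm a ++ Delta) ++ map item_fm (items mu))).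
  have := perm_map item_fm p2; rewrite map_cat => {}p2; permut.
rewrite -[rule_fm r](@map_fm_id _ _ id) //.
apply: (@derivable_forallsL _ _ _ _ _ g) => /=.
  move=> z; rewrite inE /= => zX; rewrite /g /b not_fnd //=.
  by move: zX; rewrite rule_type.
apply: d_lolliL; last exact: derivable_contL.
(* Avoiding [F] keeps the new inner nodes off the context; avoiding [vals b] keeps them off the
   external nodes, which gives injectivity of [mu']. *)
apply: (@derivable_contR _ _ _ _ _ (F ++ vals b)) => // mu' mE mJ mF.
have eb : fcomp mu' (ext (lhs r)) = b.
  apply/fmapP => s; rewrite fcompE /b fcompE.
  case: (boolP (s \in htype (lhs r))) => sX; last first.
    have sX' : s \notin domf (ext (rhs r)) by move: sX; rewrite rule_type.
    by rewrite (not_fnd sX) (not_fnd sX').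
  have sX' : s \in domf (ext (rhs r)) by move: sX; rewrite rule_type.
  rewrite (in_fnd sX) (in_fnd sX') /=; congr Some.
  by rewrite (mE s) ?(gE s) // in_fnd.
have mI' : injective mu'.
  have in_b v : v \in vals (ext (lhs r)) -> mu' v \in vals b.
    by rewrite -eb vals_fcomp => vX; apply: map_f.
  have mix v w : v \in vals (ext (lhs r)) -> w \notin vals (ext (lhs r)) -> mu' v <> mu' w.
    move=> vX wX vw; move: (mF w wX).
    by rewrite mem_cat negb_or -vw in_b // andbF.
  apply: injective_ext mix; last by move=> v w; exact: mJ.
  by rewrite eb; apply: finj_fcomp.
have [|nu1 [nI1 p1 e1]] := Hmu mu' mI' eb.
  by move=> w /mF; rewrite mem_cat negb_or => /andP[].
apply: (d_perm _ (d1 nu1 nI1 _)); last by rewrite e1.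
have := perm_map item_fm p1; rewrite map_cat => {}p1; permut.
Qed.

Lemma ht_steps_proves n G H : ht_steps S n G H ->
  exists Rs, [/\ size Rs = n, {subset Rs <= rule_fms} &
    forall d Delta, proves G d Delta -> proves H d (Rs ++ Delta)].
Proof.
elim=> {n G H} [G H iGH|n G1 G2 H /ht_step_proves[R RR s1] _ [Rs [sz sub s2]]].
  exists [::]; split=> // d Delta dG nu nI e.
  have [nu' [nI' p' e']] := iso_items iGH nI.
  apply: (d_perm _ (dG nu' nI' _)); last by rewrite e'.
  by rewrite perm_cat2r perm_map.
exists (Rs ++ [:: R]); split.
- by rewrite size_cat sz addn1.
- by move=> x; rewrite mem_cat inE => /orP[/sub//|/eqP->].
- by move=> d Delta /s1/s2; rewrite -catA.
Qed.

(** * Soundness *)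

Section Soundness.
Variable d : {fmap var -> var}.

(** [d] fixes the variables of the external nodes, which stay the same in all intermediate
    hypergraphs. *)
Definition pole (m : seq (option C * seq var)) : Prop :=
  uniq (toks m) -> exists n G (nu : node G -> var),
    [/\ ht_steps S n (start S) G, injective nu, perm_eq (items nu) m
      & fcomp nu (ext G) = d].

Lemma pole_perm m m' : perm_eq m m' -> pole m -> pole m'.
Proof.
move=> mm' Pm u; have um : uniq (toks m) by rewrite (perm_uniq (perm_toks mm')).
have [n [G [nu [sG nI p e]]]] := Pm um.
by exists n, G, nu; split=> //; apply: perm_trans p mm'.
Qed.

(** A nonzero code stands for the closure of the single item with that code and these arguments;
    [known] makes this item unique. *)
Definition atm (p : nat) (xs : seq var) (m : seq (option C * seq var)) : Prop :=
  if p == 0 then pole m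
  else fact pole (fun m => exists x, [/\ known symbols x, enc symbols x = p
                                     & m = [:: (x, xs)]]) m.

Lemma atm_closed p xs m : fact pole (atm p xs) m -> atm p xs m.
Proof.
rewrite /atm; case: (p == 0); last exact: fact_idem.
(* Testing with the empty multiset shows that [pole] itself is closed. *)
by move=> Fm; apply: (Fm [::]).
Qed.

Notation sem := (sem pole atm).

Lemma sem_item x rho : known symbols x.1 -> sem (item_fm x) rho [:: ren_item rho x].
Proof.
move=> kx; rewrite /= /atm; have -> : (enc symbols x.1 == 0) = false by case: x.1.
by apply: fact_unit; exists x.1.
Qed.

Lemma sem_lollis xs rho m : (forall x, x \in xs -> known symbols x.1) ->
  sem (lollis (map item_fm xs) goal) rho m <-> pole (m ++ map (ren_item rho) xs).
Proof.
elim: xs m => [|x xs IH] m kn; first by rewrite /= /atm cats0.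
have {}IH k : sem (lollis (map item_fm xs) goal) rho k <->
    pole (k ++ map (ren_item rho) xs).
  by apply: IH => y yx; apply: kn; rewrite inE yx orbT.
have kx := kn x (mem_head _ _); split=> [H|Pm a].
  have /IH := H _ (sem_item rho kx); apply: pole_perm; permut.
rewrite /= /atm; have -> : (enc symbols x.1 == 0) = false by case: x.1.
move=> Fa; apply/IH; apply: (@pole_perm ((m ++ map (ren_item rho) xs) ++ a)).
  by permut.
apply: Fa => _ [y [ky exy ->]]; rewrite (enc_inj ky kx exy).
by apply: pole_perm Pm; rewrite /ren_item; permut.
Qed.

Lemma sem_cont (L : hypergraph C) rho m : Defs.over symbols L ->
  sem (cont L) rho m <->
  forall rho', {in predC (mem (inner L)), rho' =1 rho} ->
    pole (m ++ items (rho' \o @name C L)).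
Proof.
move=> oL; rewrite sem_foralls.
have kn x : x \in items (@name C L) -> known symbols x.1.
  by rewrite mem_cat => /orP[/mapP[e _ ->]|/mapP[v _ ->]] //=; apply: oL.
split=> H rho' /H.
  by move/(sem_lollis _ _ kn); rewrite items_ren.
by rewrite items_ren => Hp; apply/(sem_lollis _ _ kn).
Qed.

(** Distinct tokens on the right-hand side make the external nodes distinct. The hypothesis on the
    left-hand side may be used with any names of its inner nodes, so fresh ones are chosen, and one
    more step extends the derivation it provides. *)
Lemma sem_rule r rho : List.In r (rules S) -> sem (rule_fm r) rho [::].
Proof.
move=> rS; have [ol or] := rules_over rS.
have li := @lhs_inj _ r; have ri := @rhs_inj _ r.
apply/sem_foralls => {}rho _ a; rewrite cat0s => /(sem_cont _ _ ol) Ha.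
apply/(sem_cont _ _ or) => rho2 E2 u'.
(* [F] contains the variables of [d] as well: a node that the rule deletes must not be external in
   the whole hypergraph. *)
pose F := flatten [seq x.2 | x <- a] ++ vals d ++ map rho (htype (lhs r)).
(* Shifting past the sum of [F] avoids [F] and keeps distinct inner names distinct. *)
pose rho1 z := if z \in inner (lhs r) then (fresh_var F + z)%N else rho z.
have E1 : {in predC (mem (inner (lhs r))), rho1 =1 rho}.
  by move=> z; rewrite /rho1; case: ifP => // zi /negP[].
have rho1F z : z \in inner (lhs r) -> rho1 z \notin F.
  move=> zi; rewrite /rho1 zi; apply/negP => /leq_sumn.
  by rewrite /fresh_var addSn ltnNge leq_addr.
set mu := rho1 \o @name C (lhs r); set mu' := rho2 \o @name C (rhs r).
have rhoX s : s \in htype (lhs r) -> rho1 s = rho s.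
  by move=> sX; apply: E1; rewrite inE inner_notin.
have eX : fcomp mu (ext (lhs r)) = fcomp mu' (ext (rhs r)).
  apply/fmapP => s; rewrite !fcomp_name // -rule_type; case: ifP => // sX.
  by rewrite rhoX // E2 // inE inner_notin // -rule_type.
have [u1 u2 u3] : [/\ uniq (toks a), injective mu' & forall w, [:: mu' w] \notin toks a].
  exact: uniq_toks_items u'.
have muX v : v \in vals (ext (lhs r)) -> mu v \in map rho (htype (lhs r)).
  move=> vX; have nX := name_mem li vX.
  by rewrite /mu /= rhoX // map_f.
have muF v : v \notin vals (ext (lhs r)) -> mu v \notin F.
  by move=> vX; apply: rho1F; apply: name_in_inner.
have mI : injective mu.
  have mix v w : v \in vals (ext (lhs r)) -> w \notin vals (ext (lhs r)) -> mu v <> mu w.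
    by move=> /muX vX /muF wX vw; rewrite !mem_cat -vw vX !orbT in wX.
  apply: injective_ext mix; first by rewrite eX; apply: finj_fcomp.
  move=> v w vX wX vw; apply: (name_inj li).
  by move: vw; rewrite /mu /= /rho1 !name_in_inner // => /addnI.
have ta v : [:: v] \in toks a -> v \in F.
  case/mapP=> x; rewrite mem_filter => /andP[_ xa] vx; rewrite mem_cat; apply/orP; left.
  by apply/flattenP; exists x.2; rewrite ?map_f // -vx mem_head.
(* Inner nodes are fresh for [a]; external ones carry the variables of the right-hand side, whose
   tokens differ from those of [a] by [u3]. *)
have u : uniq (toks (a ++ items mu)).
  rewrite toks_cat toks_items cat_uniq u1 /= map_inj_uniq ?enum_uniq ?andbT; last first.
    by move=> v w [] /mI.
  apply/hasPn => _ /mapP[v _ ->]; apply/negP => va.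
  case: (boolP (v \in vals (ext (lhs r)))) => vX; last first.
    by have := ta _ va; rewrite (negPf (muF _ vX)).
  have : mu v \in vals (fcomp mu' (ext (rhs r))) by rewrite -eX vals_fcomp map_f.
  by rewrite vals_fcomp => /mapP[w _ vw]; move: (u3 w); rewrite -vw va.
have [n [G [nu [sG nI p e]]]] := Ha rho1 E1 u.
have [||G' [nu' [nI' p' e' sGG']]] := items_ht_step rS nI mI p eX u'.
- move=> w x wX xa; apply: contra (muF _ wX) => wx; rewrite mem_cat; apply/orP; left.
  by apply/flattenP; exists x.2; rewrite ?map_f.
- by move=> w wX; rewrite e; apply: contra (muF _ wX) => wd; rewrite !mem_cat wd orbT.
exists n.+1, G', nu'; split=> //; last by rewrite e'.
exact: ht_steps_rcons sG sGG'.
Qed.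

(** Rule formulas hold for the empty multiset, so tensoring them to an item leaves its multiset
    unchanged. *)
Lemma sem_load A Rs rho m : sem A rho m -> {subset Rs <= rule_fms} ->
  sem (load A Rs) rho m.
Proof.
move=> Am; elim: Rs => //= R Rs IH sub; apply: fact_unit; exists m, [::].
split; first by rewrite cats0.
  by apply: IH => x xR; apply: sub; rewrite inE xR orbT.
by have [r rS ->] := mem_rule_fms (sub _ (mem_head _ _)); apply: sem_rule.
Qed.

Lemma semctx_map (T : Type) (s : seq T) (A : T -> formula) (x : T -> option C * seq var) rho :
  (forall t, sem (A t) rho [:: x t]) -> semctx pole atm (map A s) rho (map x s).
Proof.
by move=> H; elim: s => //= t s IH; exists [:: x t], (map x s).
Qed.

End Soundness.

(** * The grammar *)

Definition edge_fm (c : C) : formula := item_fm (Some c, enum_fset (sel_type c)).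

Definition node_fm : formula := item_fm (None, [:: x_bullet]).

Definition lex (k : nat) : seq (option C * formula) :=
  [seq (Some c, B) | c <- enum_fset (term S), B <- loads rule_fms k (edge_fm c)] ++
  [seq (None, B) | B <- loads rule_fms k node_fm].

(** Proving it puts the continuation of the start hypergraph into the antecedent, which closes the
    derivation when exactly the items of that hypergraph are left. *)
Definition start_fm : formula := Lolli (cont (start S)) goal.

Lemma lex_edgeP k c B : (Some c, B) \in lex k ->
  c \in term S /\ exists2 Rs, {subset Rs <= rule_fms} & B = load (edge_fm c) Rs.
Proof.
rewrite mem_cat => /orP[/allpairsPdep[c' [B' [cT BL [-> ->]]]]|/mapP[? _ []//]].
by split=> //; apply: loadsP BL.
Qed.

Lemma lex_nodeP k B : (None, B) \in lex k ->
  exists2 Rs, {subset Rs <= rule_fms} & B = load node_fm Rs.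
Proof.
rewrite mem_cat => /orP[/allpairsPdep[c' [B' [_ _ []//]]]|/mapP[B' BL [->]]].
exact: loadsP BL.
Qed.

Lemma lex_edge k c B : (Some c, B) \in lex k -> c \in term S /\ {subset fvar B <= sel_type c}.
Proof.
case/lex_edgeP=> cT [Rs sub ->]; split=> //.
by rewrite fvar_load => [x|R /sub]; [|exact: rule_fms_closed].
Qed.

Lemma lex_node k B : (None, B) \in lex k -> {subset fvar B <= [:: x_bullet]}.
Proof.
case/lex_nodeP=> Rs sub ->.
by rewrite fvar_load => [x|R /sub]; [|exact: rule_fms_closed].
Qed.

Lemma start_fm_fvar : {subset fvar start_fm <= htype (start S)}.
Proof.
by move=> x; rewrite /= cats0; apply: fvar_cont; apply: start_inj.
Qed.

Definition grammar (k : nat) : mill1_grammar C :=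
  Mill1Grammar (@lex_edge k) (@lex_node k) start_fm_fvar.

Lemma subst_edge_fm (H : hypergraph C) (nu : node H -> var) (e : edge H) :
  subst (fcomp nu (att e)) (edge_fm (lab e)) =
  item_fm (Some (lab e), map nu (vals (att e))).
Proof.
by rewrite /subst /= -vals_fcomp map_sel_type //= att_dom.
Qed.

Lemma subst_node_fm v : subst [fmap].[x_bullet <- v] node_fm = item_fm (None, [:: v]).
Proof. by rewrite /subst /= fnd_set eqxx. Qed.

Lemma grammar_sound k H : mill1_language (grammar k) H -> ht_language S H.
Proof.
case=> eX [nu [hV [hE [nI lV lE dS]]]]; rewrite /= in eX.
have oT : Defs.over (term S) H by move=> e; have [] := lex_edgeP (lE e).
split=> //; set d := fcomp nu (ext H) in dS.
have ctx : semctx (pole d) (atm d)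
    ([seq subst (fcomp nu (att e)) (hE e) | e <- enum (edge H)] ++
     [seq subst [fmap].[x_bullet <- nu v] (hV v) | v <- enum (node H)]) id (items nu).
  apply/semctx_cat; do 2 eexists; split; first exact: perm_refl.
    apply: semctx_map => e; have [cT [Rs sub ->]] := lex_edgeP (lE e).
    rewrite subst_load => [|R /sub]; last exact: rule_fms_closed.
    apply: sem_load => //; rewrite subst_edge_fm.
    have := @sem_item d (Some (lab e), map nu (vals (att e))) id.
    rewrite /ren_item /= map_id; apply.
    by rewrite inE cT orbT.
  apply: semctx_map => v; have [Rs sub ->] := lex_nodeP (lV v).
  rewrite subst_load => [|R /sub]; last exact: rule_fms_closed.
  apply: sem_load => //; rewrite subst_node_fm.
  exact: (@sem_item d (None, [:: nu v]) id).
have := sem_sound (@pole_perm d) (@atm_closed d) dS ctx [::].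
rewrite cats0 /= => /(_ _) P.
(* Zero steps lead from the start hypergraph to itself, so its continuation holds for the empty
   multiset. *)
have /P : sem (pole d) (atm d) (map_fm (fun x => odflt x d.[? x]) (cont (start S))) id [::].
  rewrite sem_map; apply/(sem_cont _ _ _ (@start_over _ S)) => rho E u.
  have sI := @start_inj _ S.
  exists 0, (start S), (rho \o @name C (start S)); split.
  - exact: ht_steps0 (iso_refl _).
  - by have [] := @uniq_toks_items _ [::] _ _ u.
  - by [].
  - apply/fmapP => s; rewrite fcomp_name //; case: ifP => sX.
      rewrite E ?inE ?inner_notin //=.
      by case: fndP => // sd; case/negP: sd; rewrite -[domf d]/(htype H) eX.
    by apply/esym/not_fnd; change (s \notin htype H); rewrite eX sX.
(* The nodes of [H] have distinct variables, so the proviso in [pole] is met. *)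
rewrite /atm /= => /(_ _)[|n [G [nu' [sG nI' p e]]]]; first by have [] := items_wf nI.
by exists n; apply: ht_steps_isoR sG _; apply: items_iso p e.
Qed.

Lemma grammar_complete k n H : Defs.over (term S) H -> n <= k * hsize H ->
  ht_steps S n (start S) H -> mill1_language (grammar k) H.
Proof.
move=> oT nk sH; split; first exact: ht_steps_htype sH.
have [Rs [szR sub pr]] := ht_steps_proves sH.
(* Nodes carry rule formulas as well as edges, so there are [hsize H] carriers even when edges are
   few. *)
pose s : seq (edge H + node H) := map inl (enum (edge H)) ++ map inr (enum (node H)).
have us : uniq s.
  rewrite cat_uniq map_inj_uniq ?enum_uniq; last by move=> ? ? [].
  rewrite map_inj_uniq ?enum_uniq; last by move=> ? ? [].
  by rewrite andbT; apply/hasPn => _ /mapP[v _ ->]; apply/mapP => -[].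
have ss : size s = hsize H by rewrite size_cat (size_map inl) (size_map inr) /hsize addnC !cardE.
have [|ch [chk chE]] := @distribute _ _ s Rs k us; first by rewrite szR ss.
have chs x : x \in s -> {subset ch x <= rule_fms}.
  move=> xs R Rx; apply: sub; rewrite -chE; apply/flattenP.
  by exists (ch x); rewrite ?map_f.
have s_all x : x \in s.
  by rewrite mem_cat; case: x => x; apply/orP; [left|right]; rewrite map_f ?mem_enum.
pose nu (v : node H) : var := enum_rank v.
have nI : injective nu by move=> v w /ord_inj/enum_rank_inj.
exists nu, (fun v => load node_fm (ch (inr v))), (fun e => load (edge_fm (lab e)) (ch (inl e))).
split=> //.
- move=> v; rewrite /= mem_cat; apply/orP; right; apply: map_f.
  by apply: mem_loads => //; apply: chs.
- move=> e; rewrite /= mem_cat; apply/orP; left; apply: allpairs_f_dep; first exact: oT.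
  by apply: mem_loads => //; apply: chs.
set d := fcomp nu (ext H); pose sigma := subst d (cont (start S)).
apply: (@d_lolliR _ sigma goal).
pose I (x : edge H + node H) := match x with
  | inl e => (Some (lab e), map nu (vals (att e)))
  | inr v => (None, [:: nu v]) end.
have -> : [seq subst (fcomp nu (att e)) (load (edge_fm (lab e)) (ch (inl e))) | e <- enum (edge H)] ++
     [seq subst [fmap].[x_bullet <- nu v] (load node_fm (ch (inr v))) | v <- enum (node H)] =
   [seq load (item_fm (I x)) (ch x) | x <- s].
  rewrite map_cat -(map_comp _ inl) -(map_comp _ inr); congr cat; apply: eq_map => x /=.
    rewrite subst_load ?subst_edge_fm // => R /(chs _ (s_all _)); exact: rule_fms_closed.
  rewrite subst_load ?subst_node_fm // => R /(chs _ (s_all _)); exact: rule_fms_closed.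
apply: (@d_perm ([seq load (item_fm (I x)) (ch x) | x <- s] ++ [:: sigma])).
  by rewrite perm_catC.
apply: derivable_loads; rewrite chE.
have -> : [seq item_fm (I x) | x <- s] = map item_fm (items nu).
  by rewrite /items !map_cat -!(map_comp item_fm) -(map_comp _ inl) -(map_comp _ inr).
apply: (pr d) => // nu' nI' e'.
rewrite cats1; apply: (@d_perm (sigma :: map item_fm (items nu'))).
  by rewrite perm_sym perm_rcons.
apply: derivable_contL; first exact: start_inj.
move=> t v tv; rewrite -/d -e' fcompE tv //.
Qed.

End Grammar.

Theorem theorem25 (C : alphabet) (G : ht_system C) :
  linear_time G ->
  exists G' : mill1_grammar C,
    forall H : hypergraph C, mill1_language G' H <-> ht_language G H.
Proof.
case=> c lin; exists (grammar G c) => H; split; first exact: grammar_sound.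
move=> LH; have [n [nc sH]] := lin H LH.
exact: grammar_complete LH.1 nc sH.
Qed.
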